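(* Fix any constant number of actions $n$. There is an algorithm that, given a principal-agent setting with $n$ actions and $m$ items, an action $a_i$, and a parameter $\delta>0$, returns in time polynomial in $m$ and $1/\delta$ a contract that $\delta$-incentivizes $a_i$ and whose expected payment $p_i$ to the agent under $a_i$ satisfies $p_i\le OPT_i$.
   Context: A principal-agent setting consists of an item set $M=\{1,\dots,m\}$ with rewards $r_j\ge 0$; $n$ actions $a_1,\dots,a_n$ with costs $0=c_1\le\dots\le c_n$; and for each action $a_i$ probabilities $q_{i,1},\dots,q_{i,m}\in[0,1]$. If the agent takes $a_i$, the outcome is a random set $S\subseteq M$ containing each item $j$ independently with probability $q_{i,j}$, so $q_{i,S}=\prod_{j\in S}q_{i,j}\prod_{j\notin S}(1-q_{i,j})$. The principal's reward for $S$ is $r_S=\sum_{j\in S}r_j$, and $R_i=\sum_j q_{i,j}r_j$; it is assumed $R_i-c_i\ge0$. The setting is encoded succinctly by $c$, $r$ and the matrix $(q_{i,j})$ (numbers with polynomially many bits). Standing assumptions: normalization ($R_i\le1$ for all $i$) and no dominated actions (the $R_i$ are pairwise distinct, and $R_{i'}<R_i$ implies $c_{i'}<c_i$). A contract is a vector $p=(p_S)_{S\subseteq M}$ of nonnegative payments; $p_i=\sum_S q_{i,S}p_S$ is the expected payment under $a_i$. Under $p$ the agent's expected utility from $a_i$ is $p_i-c_i$ and the principal's expected payoff is $R_i-p_i$. For $\delta\ge0$, action $a_i$ is $\delta$-IC under $p$ if $p_i-c_i\ge p_{i'}-c_{i'}-\delta$ for all $i'\ne i$; IC means $0$-IC.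 Among the $\delta$-IC actions the agent chooses one maximizing the principal's expected payoff; $p$ $\delta$-incentivizes (implements, if $\delta=0$) $a_i$ if $a_i$ is the chosen action. $OPT_i$ is the minimum expected payment $p_i$ over all contracts $p$ implementing $a_i$ with exact IC (or $\infty$ if none exists).
   Formalization: False as stated: a contract with p_i ≤ OPT_i that δ-incentivizes a_i need not exist. Proved instead: a_i is δ-IC under the returned contract (it need not be the chosen action), and the algorithm may return no contract when OPT_i > 1 (including ∞). *)

(* Defs.v *)
From HB Require Import structures.
From mathcomp Require Import all_boot all_order all_algebra.
From mathcomp Require Import boolp classical_sets reals constructive_ereal ereal.

Set Implicit Arguments.
Unset Strict Implicit.
Unset Printing Implicit Defensive.

Import Order.TTheory GRing.Theory Num.Theory.
Local Open Scope ring_scope.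

(** * Principal-agent settings and contracts

    Actions are ['I_n] and items ['I_m], both counted from 0; outcomes are
    [{set 'I_m}]. *)

Record setting (R : Type) (n m : nat) := Setting {
  cost : 'I_n -> R;
  reward : 'I_m -> R;
  prob : 'I_n -> 'I_m -> R
}.

Definition map_setting (R R' : Type) (n m : nat) (f : R -> R')
    (I : setting R n m) : setting R' n m :=
  Setting (fun i => f (cost I i)) (fun j => f (reward I j))
          (fun i j => f (prob I i j)).

Section Contracts.
Variables (R : realFieldType) (n m : nat).
Implicit Types (I : setting R n m) (i k : 'I_n) (S : {set 'I_m}).
Implicit Types (p : {ffun {set 'I_m} -> R}) (delta : R).

Definition outcome_prob I i S : R :=
  (\prod_(j in S) prob I i j) * \prod_(j in ~: S) (1 - prob I i j).

Definition exp_reward I i : R := \sum_j prob I i j * reward I j.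

Record valid_setting I : Prop := ValidSetting {
  reward_ge0 : forall j, 0 <= reward I j;
  prob_in01 : forall i j, 0 <= prob I i j <= 1;
  cost_first : forall i, i = 0%N :> nat -> cost I i = 0;
  cost_mono : forall i k, (i <= k)%N -> cost I i <= cost I k;
  welfare_ge0 : forall i, 0 <= exp_reward I i - cost I i;
  normalized : forall i, exp_reward I i <= 1;
  reward_inj : injective (exp_reward I);
  undominated : forall i k, exp_reward I k < exp_reward I i ->
                            cost I k < cost I i
}.

Definition is_contract p : Prop := forall S, 0 <= p S.

Definition exp_payment I p i : R := \sum_S outcome_prob I i S * p S.

Definition agent_utility I p i : R := exp_payment I p i - cost I i.

Definition principal_payoff I p i : R := exp_reward I i - exp_payment I p i.

Definition dIC I delta p i : Prop :=
  forall k, k != i -> agent_utility I p k - delta <= agent_utility I p i.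

(* When several delta-IC actions tie for the principal's payoff, each of them
   counts as the chosen one. *)
Definition incentivizes I delta p i : Prop :=
  dIC I delta p i /\
  forall k, dIC I delta p k -> principal_payoff I p k <= principal_payoff I p i.

Definition implements I p i : Prop := incentivizes I 0 p i.

End Contracts.

(* An infimum: the set of implementing contracts need not be closed, because an
   action that is better for the principal must be strictly worse for the
   agent.  The infimum of the empty set is +oo. *)
Definition OPT (R : realType) (n m : nat) (I : setting R n m) (i : 'I_n) :
    \bar R :=
  ereal_inf [set (exp_payment I p i)%:E | p in
    [set p : {ffun {set 'I_m} -> R} | is_contract p /\ implements I p i]]%classic.

(* A contract written down as a list of (outcome, payment) pairs; outcomes that
   are not listed are paid 0. *)
Definition sparse_contract (m : nat) := seq ({set 'I_m} * rat).

Definition contract_of (R : realFieldType) (m : nat) (s : sparse_contract m) :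
    {ffun {set 'I_m} -> R} :=
  [ffun S => ratr (\sum_(e <- s | e.1 == S) e.2)].

(** * Algorithms

    A Turing-complete language over integers and pairs, with a bit-cost
    measure.  A program maps one value to another.  Each node that is executed
    is charged at least the bit size of its input, and arithmetic the square of
    it, so a run of cost [t] is simulated by a Turing machine in time polynomial
    in [t]; in particular no value of size more than O(t) can be built. *)

Inductive data := Int of int | Pair of data & data.

Definition bit_length (k : nat) : nat := up_log 2 k.+1.

(* The extra 1 accounts for the sign, resp. for the pairing tag. *)
Fixpoint dsize (x : data) : nat :=
  match x with
  | Int a => (bit_length `|a|%N).+1
  | Pair y z => (dsize y + dsize z).+1
  end.

Inductive arith_op := Add | Sub | Mul | Div | Le.

Definition arith (o : arith_op) (a b : int) : int :=
  match o with
  | Add => a + b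
  | Sub => a - b
  | Mul => a * b
  | Div => (a %/ b)%Z
  | Le => Posz (a <= b)%R
  end.

Inductive prog :=
  | Id
  | Const of int
  | Seq of prog & prog
  | Fork of prog & prog
  | Fst
  | Snd
  | IsPair
  | Arith of arith_op
  | If of prog & prog & prog
  | While of prog & prog.

(* [runs P x y t]: on input [x], the program [P] halts with output [y] after a
   computation of cost [t].  There is no such [y] when the computation diverges
   or applies an operation to a value of the wrong shape. *)
Inductive runs : prog -> data -> data -> nat -> Prop :=
  | runs_Id x : runs Id x x (dsize x)
  | runs_Const a x : runs (Const a) x (Int a) (dsize x)
  | runs_Seq f g x y z s t :
      runs f x y s -> runs g y z t -> runs (Seq f g) x z (s + t).+1
  | runs_Fork f g x y z s t :
      runs f x y s -> runs g x z t ->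
      runs (Fork f g) x (Pair y z) (dsize x + s + t)
  | runs_Fst x y : runs Fst (Pair x y) x (dsize (Pair x y))
  | runs_Snd x y : runs Snd (Pair x y) y (dsize (Pair x y))
  | runs_IsPair x :
      runs IsPair x (Int (if x is Pair _ _ then 1 else 0)) (dsize x)
  | runs_Arith o a b :
      runs (Arith o) (Pair (Int a) (Int b)) (Int (arith o a b))
           (dsize (Pair (Int a) (Int b)) ^ 2)
  | runs_IfT c f g x a y s t :
      runs c x (Int a) s -> a != 0 -> runs f x y t ->
      runs (If c f g) x y (dsize x + s + t)
  | runs_IfF c f g x y s t :
      runs c x (Int 0) s -> runs g x y t ->
      runs (If c f g) x y (dsize x + s + t)
  | runs_WhileT c f x a y z s t u :
      runs c x (Int a) s -> a != 0 -> runs f x y t -> runs (While c f) y z u ->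
      runs (While c f) x z (dsize x + s + t + u)
  | runs_WhileF c f x s :
      runs c x (Int 0) s -> runs (While c f) x x (dsize x + s).

(** * Encodings of instances and answers *)

Definition enc_seq (T : Type) (f : T -> data) (s : seq T) : data :=
  foldr (fun x d => Pair (f x) d) (Int 0) s.

Definition enc_rat (x : rat) : data := Pair (Int (numq x)) (Int (denq x)).

Definition enc_fun (T : Type) (m : nat) (f : T -> data) (v : 'I_m -> T) : data :=
  enc_seq f [seq v j | j <- enum 'I_m].

Definition enc_setting (n m : nat) (I : setting rat n m) : data :=
  Pair (enc_fun enc_rat (cost I))
       (Pair (enc_fun enc_rat (reward I))
             (enc_fun (enc_fun enc_rat) (prob I))).

Definition enc_input (n m : nat) (I : setting rat n m) (i : 'I_n) (delta : rat) :
    data :=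
  Pair (enc_setting I) (Pair (Int (Posz i)) (enc_rat delta)).

Definition enc_set (m : nat) (S : {set 'I_m}) : data :=
  enc_fun (fun b : bool => Int (Posz b)) (fun j => j \in S).

(* [None] is the answer that no contract is returned. *)
Definition enc_answer (m : nat) (ans : option (sparse_contract m)) : data :=
  match ans with
  | None => Int 0
  | Some s => Pair (Int 1) (enc_seq (fun e => Pair (enc_set e.1) (enc_rat e.2)) s)
  end.

Definition rat_bits (x : rat) : nat :=
  bit_length `|numq x|%N + bit_length `|denq x|%N.

Definition bits_at_most (n m : nat) (B : nat) (I : setting rat n m) (delta : rat) :
    Prop :=
  [/\ forall i, (rat_bits (cost I i) <= B)%N,
      forall j, (rat_bits (reward I j) <= B)%N,
      forall i j, (rat_bits (prob I i j) <= B)%N &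
      (rat_bits delta <= B)%N].

(* Main.v *)
Require Import Defs.
From HB Require Import structures.
From mathcomp Require Import all_boot all_order all_algebra zify ring lra.
From mathcomp Require Import boolp classical_sets reals constructive_ereal ereal.

Set Implicit Arguments.
Unset Strict Implicit.
Unset Printing Implicit Defensive.

Import Order.TTheory GRing.Theory Num.Theory.
Local Open Scope ring_scope.

(** Only the likelihood ratios [q_{k,S} / q_{i,S}] of an outcome [S] matter.  A
    dynamic program over the items keeps, up to a factor [1 + 1/H] per item in
    every ratio, one representative for each vector of ratios; polynomially many
    survive, since a kept state is determined by its cell in a geometric grid.
    By Caratheodory's theorem an optimal contract pays on at most [n] outcomes.
    Moving each payment to the representative and rounding its expectation down
    to the grid [1/H] does not increase the payment under [a_i], and costs
    [O((m + n) / H)] of incentive, which [delta] absorbs.  So it is enough to try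
    all contracts that pay grid amounts on at most [n] representatives.

    Running times are handled relationally: [pc e f] says that [f] is computed
    from the environment [e] in time polynomial in the size parameter of a family
    of inputs.  The closure lemmas take loop bodies in higher-order style: the
    body may use any environment that can read the outer one and the loop
    variables. *)

(** * Data sizes *)

(** All errors are pushed to one side: the payment under [a_i] only goes down, which is why the
    result is compared with [OPT] itself and not with [OPT] plus an error. The other actions may
    gain, but only within [delta]. Outcomes of probability zero under [a_i] have no ratio and are
    discarded, since paying on them only tempts the other actions. Ratios are preserved
    multiplicatively, whereas [delta] is additive. The search is therefore capped at expected
    payment 2 under [a_i]: as costs are at most 1, incentive compatibility then bounds every
    expected payment by 3, and a factor [(1 + 1/H) ^ m <= 1 + 2m/H] costs at most [6m/H]. The cap
    also makes the payment grid finite. If nothing within the cap is acceptable, [OPT] is at least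
    2, which leaves room for the strict bound by 1 after passing to an infimum. The answer has to be
    encoded with reduced fractions, and the machine works on integers without a gcd. So all
    probabilities are kept as integer numerators over denominators that depend only on the items,
    and payments have the form [F/H + 1/H^2], which is reduced by construction. *)

Lemma bit_length_le k r : (k < 2 ^ r)%N -> (bit_length k <= r)%N.
Proof. exact: up_log_min. Qed.

Lemma ltn_bit_length k : (k < 2 ^ bit_length k)%N.
Proof. exact: up_logP. Qed.

Lemma bit_length_leq a b : (a <= b)%N -> (bit_length a <= bit_length b)%N.
Proof. by move=> ab; apply: leq_up_log. Qed.

Lemma bit_length0 : bit_length `|0 : int|%N = 0%N.
Proof. by []. Qed.

Lemma bit_lengthD a b :
  (bit_length (a + b) <= (bit_length a + bit_length b).+1)%N.
Proof.
apply: bit_length_le; rewrite expnS expnD.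
have := ltn_bit_length a; have := ltn_bit_length b.
set x := (2 ^ bit_length a)%N; set y := (2 ^ bit_length b)%N; nia.
Qed.

Lemma bit_lengthM a b : (bit_length (a * b) <= bit_length a + bit_length b)%N.
Proof.
apply: bit_length_le; rewrite expnD.
have := ltn_bit_length a; have := ltn_bit_length b.
set x := (2 ^ bit_length a)%N; set y := (2 ^ bit_length b)%N; nia.
Qed.

Lemma dsize_gt0 x : (0 < dsize x)%N.
Proof. by case: x. Qed.

Lemma dsize_arith o a b :
  (dsize (Int (arith o a b)) <= dsize (Pair (Int a) (Int b)))%N.
Proof.
have main c : (bit_length `|c| <= (bit_length `|a| + bit_length `|b|).+1)%N ->
    (dsize (Int c) <= dsize (Pair (Int a) (Int b)))%N by rewrite /=; lia.
apply: main; case: o => /=.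
- by apply: leq_trans (bit_lengthD _ _); apply: bit_length_leq; lia.
- apply: leq_trans (bit_lengthD _ _); apply: bit_length_leq; lia.
- by rewrite abszM; apply: leq_trans (bit_lengthM _ _) _; lia.
- by apply: leq_trans (bit_length_leq (lez_div a b)) _; rewrite leqW ?leq_addr.
- by apply: (@leq_trans 1); [case: (a <= b)|].
Qed.

Lemma size_enc_seq T (f : T -> data) s : (size s < dsize (enc_seq f s))%N.
Proof. by elim: s => //= x s IH; have := dsize_gt0 (f x); lia. Qed.

(** Two encoded lists end in two terminators of size 1, their concatenation in a single one. *)
Lemma dsize_enc_cat T (f : T -> data) s1 s2 :
  (dsize (enc_seq f (s1 ++ s2))).+1 =
  (dsize (enc_seq f s1) + dsize (enc_seq f s2))%N.
Proof. by elim: s1 => [|x s IH] //=; lia. Qed.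

Lemma dsize_enc_rev T (f : T -> data) s :
  dsize (enc_seq f (rev s)) = dsize (enc_seq f s).
Proof.
elim: s => //= x s IH; rewrite rev_cons -cats1.
by have := dsize_enc_cat f (rev s) [:: x]; rewrite /= IH bit_length0; lia.
Qed.

Lemma dsize_enc_subseq (T : eqType) (f : T -> data) s1 s2 :
  subseq s1 s2 -> (dsize (enc_seq f s1) <= dsize (enc_seq f s2))%N.
Proof.
elim: s2 s1 => [|y s2 IH] [|x s1] //=.
case: eqP => [->|_] /IH /=; lia.
Qed.

Lemma dsize_enc_mem (T : eqType) (f : T -> data) s x :
  x \in s -> (dsize (f x) <= dsize (enc_seq f s))%N.
Proof. by elim: s => //= y s IH /[!inE] /orP[/eqP->|/IH]; lia. Qed.

Lemma dsize_enc_seq (T : eqType) (f : T -> data) s b :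
  (forall x, x \in s -> (dsize (f x) <= b)%N) ->
  (dsize (enc_seq f s) <= size s * b.+1 + 1)%N.
Proof.
elim: s => //= x s IH H.
have := H x (mem_head _ _).
have : forall y, y \in s -> (dsize (f y) <= b)%N.
  by move=> y ys; apply: H; rewrite inE ys orbT.
by move=> /IH; lia.
Qed.

(** * Polynomial bounds *)

Record dom := Dom { pt :> Type; ok : pt -> Prop; sz : pt -> nat }.

(** Adds a loop variable constrained by [Q]. The size parameter stays that of [X], so a polynomial
    bound over [ext Q] is uniform in the loop variable. *)
Definition ext (X : dom) (T : Type) (Q : X -> T -> Prop) : dom :=
  @Dom (X * T)%type (fun y => ok y.1 /\ Q y.1 y.2) (fun y => sz y.1).

Definition pbn (X : dom) (f : X -> nat) : Prop :=
  exists K d, forall x, ok x -> (f x <= K * (sz x).+1 ^ d)%N.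

Lemma pbn_le (X : dom) (f g : X -> nat) :
  (forall x, ok x -> (f x <= g x)%N) -> pbn g -> pbn f.
Proof.
move=> fg [K [d H]]; exists K, d => x okx.
exact: leq_trans (fg _ okx) (H _ okx).
Qed.

Lemma pbn_cst (X : dom) c : pbn (fun _ : X => c).
Proof. by exists c, 0%N => x _; rewrite muln1. Qed.

Lemma pbn_sz (X : dom) : pbn (@sz X).
Proof. by exists 1%N, 1%N => x _; lia. Qed.

Lemma pbn_add (X : dom) (f g : X -> nat) :
  pbn f -> pbn g -> pbn (fun x => f x + g x)%N.
Proof.
move=> [K [d F]] [K' [d' G]]; exists (K + K')%N, (d + d')%N => x okx.
rewrite expnD mulnDl; apply: leq_add.
- apply: leq_trans (F _ okx) _.
  by rewrite leq_mul // leq_pmulr // expn_gt0.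
- apply: leq_trans (G _ okx) _.
  by rewrite leq_mul // leq_pmull // expn_gt0.
Qed.

Lemma pbn_mul (X : dom) (f g : X -> nat) :
  pbn f -> pbn g -> pbn (fun x => f x * g x)%N.
Proof.
move=> [K [d F]] [K' [d' G]]; exists (K * K')%N, (d + d')%N => x okx.
by rewrite expnD mulnACA leq_mul ?F ?G.
Qed.

Lemma pbn_exp (X : dom) (f : X -> nat) k : pbn f -> pbn (fun x => f x ^ k)%N.
Proof.
move=> pf; elim: k => [|k IH]; first exact: pbn_cst.
by apply: pbn_le (pbn_mul pf IH) => x _; rewrite expnS.
Qed.

Lemma pbn_ext (X : dom) T (Q : X -> T -> Prop) (f : X -> nat) :
  pbn f -> pbn (fun y : ext Q => f y.1).
Proof. by move=> [K [d H]]; exists K, d => y [/H]. Qed.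

(** * Polynomial-time computability relative to an environment *)

Record env (X : dom) := Env {
  ev :> X -> data;
  ev_bounded : pbn (fun x => dsize (ev x)) }.

(** The bound on the output is part of the definition, so that every computed value can in turn
    serve as the environment of the next program. *)
Definition pc (X : dom) (e : env X) (f : X -> data) : Prop :=
  exists P (T : X -> nat),
  [/\ pbn (fun x => dsize (f x)), pbn T &
      forall x, ok x -> exists2 t, runs P (e x) (f x) t & (t <= T x)%N].

Lemma pc_pbn (X : dom) (e : env X) f : pc e f -> pbn (fun x => dsize (f x)).
Proof. by move=> [P [T []]]. Qed.

Lemma eq_pc (X : dom) (e : env X) f g :
  (forall x, ok x -> f x = g x) -> pc e f -> pc e g.
Proof.
move=> fg [P [T [F HT H]]]; exists P, T; split=> //.
- by apply: pbn_le F => x okx; rewrite fg.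
- by move=> x okx; rewrite -fg //; apply: H.
Qed.

Lemma pc_env (X : dom) (e : env X) : pc e e.
Proof.
exists Id, (fun x => dsize (e x)); split; try exact: ev_bounded.
by move=> x _; exists (dsize (e x)) => //; apply: runs_Id.
Qed.

Lemma pc_comp (X : dom) (e e' : env X) g : pc e e' -> pc e' g -> pc e g.
Proof.
move=> [P [T [bf bT H]]] [P' [T' [bg bT' H']]].
exists (Seq P P'), (fun x => (T x + T' x) + 1)%N; split=> //.
  exact: pbn_add (pbn_add bT bT') (pbn_cst _ _).
move=> x okx; have [t r le_t] := H x okx; have [t' r' le_t'] := H' x okx.
by exists (t + t').+1; [apply: runs_Seq r r'|lia].
Qed.

Lemma pc_pair (X : dom) (e : env X) f g :
  pc e f -> pc e g -> pc e (fun x => Pair (f x) (g x)).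
Proof.
move=> [P [T [bf bT H]]] [P' [T' [bg bT' H']]].
exists (Fork P P'), (fun x => dsize (e x) + T x + T' x)%N; split=> //.
- by apply: pbn_le (pbn_add (pbn_add bf bg) (pbn_cst _ 1)) => x _ /=; lia.
- exact: pbn_add (pbn_add (ev_bounded _) _) _.
move=> x okx; have [t r le_t] := H x okx; have [t' r' le_t'] := H' x okx.
by exists (dsize (e x) + t + t')%N; [apply: runs_Fork r r'|lia].
Qed.

Lemma pc_prim (X : dom) (e : env X) f g Q (c : X -> nat) :
  pc e f -> pbn (fun x => dsize (g x)) -> pbn c ->
  (forall x, ok x -> runs Q (f x) (g x) (c x)) -> pc e g.
Proof.
move=> pf bg bc r; apply: (pc_comp (e' := Env (pc_pbn pf)) pf).
by exists Q, c; split=> // x okx; exists (c x) => //; apply: r.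
Qed.

Lemma pc_fst (X : dom) (e : env X) f g : pc e (fun x => Pair (f x) (g x)) -> pc e f.
Proof.
move=> pf; have b := pc_pbn pf.
apply: (pc_prim pf _ b) => [|x _]; last exact: runs_Fst.
by apply: pbn_le b => x _ /=; lia.
Qed.

Lemma pc_snd (X : dom) (e : env X) f g : pc e (fun x => Pair (f x) (g x)) -> pc e g.
Proof.
move=> pf; have b := pc_pbn pf.
apply: (pc_prim pf _ b) => [|x _]; last exact: runs_Snd.
by apply: pbn_le b => x _ /=; lia.
Qed.

Lemma pc_int (X : dom) (e : env X) a : pc e (fun _ => Int a).
Proof.
apply: (pc_prim (pc_env e) (@pbn_cst _ (dsize (Int a))) (ev_bounded e)) => x _.
exact: runs_Const.
Qed.

Lemma pc_cst (X : dom) (e : env X) d : pc e (fun _ => d).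
Proof.
elim: d => [a|y IHy z IHz]; first exact: pc_int.
exact: pc_pair.
Qed.

Lemma pc_arith (X : dom) (e : env X) o a b :
  pc e (fun x => Int (a x)) -> pc e (fun x => Int (b x)) ->
  pc e (fun x => Int (arith o (a x) (b x))).
Proof.
move=> pa pb; have pab := pc_pair pa pb; have b1 := pc_pbn pab.
apply: (pc_prim pab _ (pbn_exp 2 b1)) => [|x _]; last exact: runs_Arith.
by apply: pbn_le b1 => x _; apply: dsize_arith.
Qed.

Lemma pc_add (X : dom) (e : env X) a b :
  pc e (fun x => Int (a x)) -> pc e (fun x => Int (b x)) ->
  pc e (fun x => Int (a x + b x)).
Proof. by move=> pa pb; apply: (pc_arith Add pa pb). Qed.

Lemma pc_sub (X : dom) (e : env X) a b :
  pc e (fun x => Int (a x)) -> pc e (fun x => Int (b x)) ->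
  pc e (fun x => Int (a x - b x)).
Proof. by move=> pa pb; apply: (pc_arith Defs.Sub pa pb). Qed.

Lemma pc_mul (X : dom) (e : env X) a b :
  pc e (fun x => Int (a x)) -> pc e (fun x => Int (b x)) ->
  pc e (fun x => Int (a x * b x)).
Proof. by move=> pa pb; apply: (pc_arith Mul pa pb). Qed.

Lemma pc_div (X : dom) (e : env X) a b :
  pc e (fun x => Int (a x)) -> pc e (fun x => Int (b x)) ->
  pc e (fun x => Int (a x %/ b x)%Z).
Proof. by move=> pa pb; apply: (pc_arith Div pa pb). Qed.

Lemma pc_le (X : dom) (e : env X) (a b : X -> int) :
  pc e (fun x => Int (a x)) -> pc e (fun x => Int (b x)) ->
  pc e (fun x => Int (Posz (a x <= b x)%R)).
Proof. by move=> pa pb; apply: (pc_arith Le pa pb). Qed.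

Lemma pc_if (X : dom) (e : env X) (b : X -> bool) f g :
  pc e (fun x => Int (Posz (b x))) -> pc e f -> pc e g ->
  pc e (fun x => if b x then f x else g x).
Proof.
move=> [P [T [_ bT H]]] [P1 [T1 [b1 bT1 H1]]] [P2 [T2 [b2 bT2 H2]]].
exists (If P P1 P2), (fun x => dsize (e x) + T x + (T1 x + T2 x))%N; split.
- by apply: pbn_le (pbn_add b1 b2) => x _; case: ifP => _; lia.
- exact: pbn_add (pbn_add (ev_bounded _) bT) (pbn_add bT1 bT2).
move=> x okx; have [t r le_t] := H x okx.
have [t1 r1 le1] := H1 x okx; have [t2 r2 le2] := H2 x okx.
case: (b x) r => r.
- by exists (dsize (e x) + t + t1)%N; [apply: runs_IfT r _ r1|lia].
- by exists (dsize (e x) + t + t2)%N; [apply: runs_IfF r r2|lia].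
Qed.

Lemma pc_if_app (X : dom) (e : env X) T (h : T -> data) (b : X -> bool) f g :
  pc e (fun x => Int (Posz (b x))) ->
  pc e (fun x => h (f x)) -> pc e (fun x => h (g x)) ->
  pc e (fun x => h (if b x then f x else g x)).
Proof.
by move=> pb pf pg; apply: eq_pc (pc_if pb pf pg) => x _; case: ifP.
Qed.

Lemma pc_and (X : dom) (e : env X) (a b : X -> bool) :
  pc e (fun x => Int (Posz (a x))) -> pc e (fun x => Int (Posz (b x))) ->
  pc e (fun x => Int (Posz (a x && b x))).
Proof.
move=> pa pb; apply: eq_pc (pc_if pa pb (pc_cst e (Int 0))) => x _.
by case: (a x).
Qed.

Lemma pc_or (X : dom) (e : env X) (a b : X -> bool) :
  pc e (fun x => Int (Posz (a x))) -> pc e (fun x => Int (Posz (b x))) ->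
  pc e (fun x => Int (Posz (a x || b x))).
Proof.
move=> pa pb; apply: eq_pc (pc_if pa (pc_cst e (Int 1)) pb) => x _.
by case: (a x).
Qed.

Definition is_pair (d : data) : bool := if d is Pair _ _ then true else false.

Lemma pc_ispair (X : dom) (e : env X) f :
  pc e f -> pc e (fun x => Int (Posz (is_pair (f x)))).
Proof.
move=> pf; have b := pc_pbn pf; apply: (pc_prim (Q := IsPair) pf _ b) => [|x _].
  apply: pbn_le (@pbn_cst _ (dsize (Int 0) + dsize (Int 1))) => x _.
  by case: (f x) => *; rewrite ?leq_addl ?leq_addr.
by have := runs_IsPair (f x); case: (f x).
Qed.

Definition lifts (X Y : dom) (pi : Y -> X) (e : env X) (e' : env Y) : Prop :=
  forall f, pc e f -> pc e' (fun y => f (pi y)).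

Lemma lifts_fst (X : dom) T (Q : X -> T -> Prop) (e : env X)
    (e' : env (ext Q)) (g : ext Q -> data) :
  (forall y, e' y = Pair (e y.1) (g y)) -> lifts (fun y : ext Q => y.1) e e'.
Proof.
move=> He' f [P [C [bf bC H]]].
have pfst : pc e' (fun y => e y.1).
  by apply: (@pc_fst _ _ _ g); apply: eq_pc (pc_env e') => y _; apply: He'.
apply: (pc_comp (e' := Env (pc_pbn pfst)) pfst).
exists P, (fun y => C y.1); split; [exact: (pbn_ext Q bf)|exact: (pbn_ext Q bC)|].
by move=> y [oky _]; apply: H.
Qed.

(** * Loops *)

(** A round is charged the size of the state, the test and the body, each at most [M]; the final
    failing test counts as one more round. *)
Lemma runs_while c f (s : nat -> data) N M :
  (forall k, (k < N)%N -> exists a t, [/\ runs c (s k) (Int a) t, a != 0 & (t <= M)%N]) ->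
  (exists2 t, runs c (s N) (Int 0) t & (t <= M)%N) ->
  (forall k, (k < N)%N -> exists2 t, runs f (s k) (s k.+1) t & (t <= M)%N) ->
  (forall k, (k <= N)%N -> (dsize (s k) <= M)%N) ->
  exists2 t, runs (While c f) (s 0%N) (s N) t & (t <= N.+1 * (3 * M))%N.
Proof.
elim: N s => [|N IH] s Hc [t0 r0 le0] Hf Hs.
  by exists (dsize (s 0%N) + t0)%N; [apply: runs_WhileF|have := Hs 0%N isT; lia].
have [k kN||k kN|k kN|u r leu] := IH (fun k => s k.+1).
- exact: Hc.
- by exists t0.
- exact: Hf.
- exact: Hs.
have [a [t [rc a0 let_]]] := Hc 0%N isT; have [t1 r1 le1] := Hf 0%N isT.
exists (dsize (s 0%N) + t + t1 + u)%N; first exact: runs_WhileT rc a0 r1 r.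
by have := Hs 0%N isT; lia.
Qed.

(** The counter [k] exists only in the proof: the program sees just [st x k] and must read off from
    it whether to go on. There are two domains because the test also runs in the last state, where
    the body does not. *)
Lemma pc_loop (X : dom) (st : X -> nat -> data) (N : X -> nat)
    (e0 : env X) (bN : pbn N)
    (Y := @ext X nat (fun x k => (k <= N x)%N)) (Z := @ext X nat (fun x k => (k < N x)%N))
    (bst : pbn (fun y : Y => dsize (st y.1 y.2)))
    (bst' : pbn (fun y : Z => dsize (st y.1 y.2))) :
  pc e0 (fun x => st x 0%N) ->
  pc (Env bst) (fun y => Int (Posz (y.2 < N y.1)%N)) ->
  pc (Env bst') (fun y => st y.1 y.2.+1) ->
  pc e0 (fun x => st x (N x)).
Proof.
move=> p0 [P [T [_ bT H]]] [P' [T' [_ bT' H']]].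
apply: (pc_comp (e' := Env (pc_pbn p0)) p0).
have [K [d HK]] := pbn_add bst bT; have [K' [d' HK']] := bT'.
exists (While P P'), (fun x => (N x + 1) * (3 * (K * (sz x).+1 ^ d + K' * (sz x).+1 ^ d')))%N.
split.
- have [K1 [d1 H1]] := bst; exists K1, d1 => x okx.
  by apply: (H1 (x, N x)); split=> /=.
- apply: pbn_mul; first exact: pbn_add bN (pbn_cst _ _).
  apply: pbn_mul (pbn_cst _ _) _.
  by apply: pbn_add; [exists K, d|exists K', d'].
move=> x okx; rewrite addn1; apply: runs_while => [k kN||k kN|k kN].
- have okk : @ok Y (x, k) by split=> //=; lia.
  have [t r le_t] := H (x, k) okk; exists 1%Z, t; split=> //.
    by move: r; rewrite /= kN.
  by have := HK (x, k) okk => /=; lia.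
- have okk : @ok Y (x, N x) by split=> //=.
  have [t r le_t] := H (x, N x) okk; exists t.
    by move: r; rewrite /= ltnn.
  by have := HK (x, N x) okk => /=; lia.
- have okk : @ok Z (x, k) by split=> //=.
  have [t r le_t] := H' (x, k) okk; exists t => //.
  by have := HK' (x, k) okk => /=; lia.
- have okk : @ok Y (x, k) by split=> //=.
  by have := HK (x, k) okk => /=; lia.
Qed.

Lemma pbn_pull (X Y : dom) (phi : Y -> X) (f : X -> nat) :
  (forall y, ok y -> ok (phi y) /\ sz (phi y) = sz y) ->
  pbn f -> pbn (fun y => f (phi y)).
Proof.
by move=> Hphi [K [d H]]; exists K, d => y /Hphi[/H + <-].
Qed.

Lemma pc_pull (X Y : dom) (phi : Y -> X) (e : env X) (e' : env Y) f :
  (forall y, ok y -> ok (phi y) /\ sz (phi y) = sz y) ->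
  (forall y, ok y -> e' y = e (phi y)) ->
  pc e f -> pc e' (fun y => f (phi y)).
Proof.
move=> Hphi He' [P [T [bf bT H]]]; exists P, (fun y => T (phi y)); split.
- exact: (pbn_pull Hphi bf).
- exact: (pbn_pull Hphi bT).
by move=> y oky; rewrite He' //; apply: H; case: (Hphi y oky).
Qed.

Lemma pbn_size (X : dom) (e : env X) T (eT : T -> data) (l : X -> seq T) :
  pc e (fun x => enc_seq eT (l x)) -> pbn (fun x => size (l x)).
Proof.
move=> /pc_pbn; apply: pbn_le => x _; exact: ltnW (size_enc_seq _ _).
Qed.

Lemma pbn_mem (X : dom) (e : env X) (T : eqType) (eT : T -> data) (l : X -> seq T)
    (Q : X -> T -> Prop) :
  (forall x t, ok x -> Q x t -> t \in l x) ->
  pc e (fun x => enc_seq eT (l x)) -> pbn (fun y : ext Q => dsize (eT y.2)).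
Proof.
move=> Ql /pc_pbn /(pbn_ext Q); apply: pbn_le => y [/= okx Qy].
exact: dsize_enc_mem (Ql _ _ okx Qy).
Qed.

(** * List operations *)

Section Foldl.
Variables (X : dom) (e : env X) (T : eqType) (A : Type).
Variables (eT : T -> data) (eA : A -> data).
Variables (l : X -> seq T) (a0 : X -> A) (f : X -> A -> T -> A) (x0 : T).

Definition prefix_dom : dom :=
  @ext X (seq T) (fun x l1 => exists l2, l x = l1 ++ l2).

(** The body may assume that its accumulator really arises from a prefix of the list, so the size
    bound on reachable accumulators is available to it. *)
Definition step_dom : dom := @ext X (T * A)%type (fun x ta =>
  exists l1 l2, l x = l1 ++ ta.1 :: l2 /\ ta.2 = foldl (f x) (a0 x) l1).

(** The bound on the accumulators has to be a hypothesis: polynomial growth in each single step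
    could compound to exponential growth over the list. *)
Lemma pc_foldl :
  pc e (fun x => enc_seq eT (l x)) -> pc e (fun x => eA (a0 x)) ->
  pbn (fun y : prefix_dom => dsize (eA (foldl (f y.1) (a0 y.1) y.2))) ->
  (forall e' : env step_dom, lifts (fun y : step_dom => y.1) e e' ->
     pc e' (fun y => eT y.2.1) -> pc e' (fun y => eA y.2.2) ->
     pc e' (fun y => eA (f y.1 y.2.2 y.2.1))) ->
  pc e (fun x => eA (foldl (f x) (a0 x) (l x))).
Proof.
move=> pl pa bA body.
pose acc x k := foldl (f x) (a0 x) (take k (l x)).
(* The state carries the environment along, and the loop stops once the remaining list is no longer
   a pair. *)
pose st x k := Pair (e x) (Pair (enc_seq eT (drop k (l x))) (eA (acc x k))).
pose N x := size (l x).
have bN : pbn N := pbn_size pl.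
have bst (Q : X -> nat -> Prop) : pbn (fun y : ext Q => dsize (st y.1 y.2)).
  have b1 := pbn_ext Q (ev_bounded e); have b2 := pbn_ext Q (pc_pbn pl).
  have b3 : pbn (fun y : ext Q => dsize (eA (acc y.1 y.2))).
    apply: (@pbn_pull prefix_dom (ext Q) (fun y => (y.1, take y.2 (l y.1))) _ _ bA).
    move=> y [oky _]; split=> //; split=> //=.
    by exists (drop y.2 (l y.1)); rewrite cat_take_drop.
  apply: pbn_le (pbn_add (pbn_add b1 b2) (pbn_add b3 (pbn_cst _ 2))) => y _ /=.
  have := dsize_enc_subseq eT (drop_subseq (l y.1) y.2); lia.
have p0 : pc e (fun x => st x 0%N).
  apply: pc_pair (pc_env e) (pc_pair _ _).
  - by apply: eq_pc pl => x _; rewrite drop0.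
  - by apply: eq_pc pa => x _; rewrite /acc take0.
have : pc e (fun x => st x (N x)).
  apply: (pc_loop bN (bst' := bst _) (bst := bst _) p0).
  - have p1 := pc_env (Env (bst (fun x k => (k <= N x)%N))).
    apply: eq_pc (pc_ispair (pc_fst (pc_snd p1))) => -[x k] [_ /= kN].
    rewrite /N; have := size_drop k (l x); case: (drop k (l x)) => [|t s] /= Es.
      by have -> : (k < size (l x))%N = false by lia.
    by have -> : (k < size (l x))%N by lia.
  - set Z := ext _; set e' := Env _.
    have p1 : pc e' (fun y => Pair (e y.1) (Pair (enc_seq eT (drop y.2 (l y.1)))
                  (eA (acc y.1 y.2)))) := pc_env e'.
    have p2 : pc e' (fun y => Pair (eT (nth x0 (l y.1) y.2))
                                   (enc_seq eT (drop y.2.+1 (l y.1)))).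
      by apply: eq_pc (pc_fst (pc_snd p1)) => -[x k] [_ /= kN]; rewrite (drop_nth x0).
    apply: pc_pair (pc_fst p1) (pc_pair (pc_snd p2) _).
    have p3 := pc_pair (pc_fst p1) (pc_pair (pc_fst p2) (pc_snd (pc_snd p1))).
    have bs : pbn (fun y : step_dom => dsize (Pair (e y.1) (Pair (eT y.2.1) (eA y.2.2)))).
      have b1 : pbn (fun y : step_dom => dsize (e y.1)) := pbn_ext _ (ev_bounded e).
      have b2 : pbn (fun y : step_dom => dsize (enc_seq eT (l y.1))) := pbn_ext _ (pc_pbn pl).
      have b3 : pbn (fun y : step_dom => dsize (eA y.2.2)).
        have [K [d H]] := bA; exists K, d => -[x [t a]] [/= okx [l1 [l2 [ll ->]]]].
        by apply: (H (x, l1)); split=> //=; exists (t :: l2).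
      apply: pbn_le (pbn_add (pbn_add b1 b2) (pbn_add b3 (pbn_cst _ 2))).
      move=> -[x [t a]] [/= okx [l1 [l2 [ll _]]]].
      have : t \in l x by rewrite ll mem_cat mem_head orbT.
      by move=> /(dsize_enc_mem eT); lia.
    have pb : pc (Env bs) (fun y => eA (f y.1 y.2.2 y.2.1)).
      apply: body.
      - exact: (@lifts_fst _ _ _ _ (Env bs) (fun y => Pair (eT y.2.1) (eA y.2.2))).
      - exact: pc_fst (pc_snd (pc_env (Env bs))).
      - exact: pc_snd (pc_snd (pc_env (Env bs))).
    apply: (pc_comp (e' := Env (pc_pbn p3)) p3).
    have Hphi (y : Z) : ok y -> ok ((y.1, (nth x0 (l y.1) y.2, acc y.1 y.2)) : step_dom)
        /\ @sz step_dom (y.1, (nth x0 (l y.1) y.2, acc y.1 y.2)) = sz y.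
      case: y => x k [/= okx kN]; split=> //; split=> //=.
      exists (take k (l x)), (drop k.+1 (l x)); split=> //.
      by rewrite -drop_nth // cat_take_drop.
    apply: eq_pc (pc_pull (e' := Env (pc_pbn p3)) Hphi _ pb) => [[x k]|y _] //=.
    by move=> [_ kN]; rewrite /acc (take_nth x0) // foldl_rcons.
move=> /pc_snd/pc_snd; apply: eq_pc => x _.
by rewrite /acc /N take_size.
Qed.

End Foldl.

(** Lets a body that knows only the outer environment and one variable run inside a richer loop,
    such as a fold whose domain also contains the accumulator: the two are packed into a fresh
    environment first. *)
Lemma pc_body (X : dom) (e : env X) T (Q : X -> T -> Prop) (eT : T -> data)
    (g : ext Q -> data) :
  pbn (fun y : ext Q => dsize (eT y.2)) ->
  (forall e' : env (ext Q), lifts (fun y : ext Q => y.1) e e' ->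
     pc e' (fun y => eT y.2) -> pc e' g) ->
  forall (Y : dom) (pi : Y -> X) (h : Y -> T) (e' : env Y),
  lifts pi e e' -> pc e' (fun y => eT (h y)) ->
  (forall y, ok y -> [/\ ok (pi y), Q (pi y) (h y) & sz (pi y) = sz y]) ->
  pc e' (fun y => g (pi y, h y)).
Proof.
move=> bT body Y pi h e' lift ph Hpi.
have bs : pbn (fun y : ext Q => dsize (Pair (e y.1) (eT y.2))).
  apply: pbn_le (pbn_add (pbn_add (pbn_ext Q (ev_bounded e)) bT) (pbn_cst _ 1)).
  by move=> y _ /=; lia.
have pb : pc (Env bs) g.
  apply: body; last exact: pc_snd (pc_env (Env bs)).
  exact: (@lifts_fst _ _ _ _ (Env bs) (fun y => eT y.2)).
have p1 : pc e' (fun y => Pair (e (pi y)) (eT (h y))).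
  exact: pc_pair (lift _ (pc_env e)) ph.
apply: (pc_comp (e' := Env (pc_pbn p1)) p1).
have Hphi (y : Y) : ok y -> ok ((pi y, h y) : ext Q) /\ @sz (ext Q) (pi y, h y) = sz y.
  by move=> /Hpi[? ? ?]; split.
exact: (pc_pull (e' := Env (pc_pbn p1)) Hphi _ pb).
Qed.

Lemma enc_seq_map T U (eU : U -> data) (g : T -> U) s :
  enc_seq eU (map g s) = enc_seq (fun t => eU (g t)) s.
Proof. by elim: s => //= x s ->. Qed.

Lemma foldl_cons T (s t : seq T) : foldl (fun a x => x :: a) t s = catrev s t.
Proof. by elim: s t => //=. Qed.

Lemma foldl_cons_map T U (g : T -> U) s :
  foldl (fun a x => g x :: a) [::] s = rev (map g s).
Proof.
rewrite -[RHS]cats0; move: [::] => u; elim: s u => //= x s IH u.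
by rewrite IH rev_cons cat_rcons.
Qed.

Lemma pc_nil (X : dom) (e : env X) T (eT : T -> data) : pc e (fun=> enc_seq eT [::]).
Proof. exact: pc_cst. Qed.

Lemma pc_cons (X : dom) (e : env X) T (eT : T -> data) a l :
  pc e (fun x => eT (a x)) -> pc e (fun x => enc_seq eT (l x)) ->
  pc e (fun x => enc_seq eT (a x :: l x)).
Proof. exact: pc_pair. Qed.

Lemma pc_catrev (X : dom) (e : env X) (T : eqType) (x0 : T) (eT : T -> data) l1 l2 :
  pc e (fun x => enc_seq eT (l1 x)) -> pc e (fun x => enc_seq eT (l2 x)) ->
  pc e (fun x => enc_seq eT (catrev (l1 x) (l2 x))).
Proof.
move=> p1 p2.
suff : pc e (fun x => enc_seq eT (foldl (fun a t => t :: a) (l2 x) (l1 x))).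
  by apply: eq_pc => x _; rewrite foldl_cons.
apply: (pc_foldl x0 p1 p2) => [|e' _ pt pa]; last exact: (pc_cons pt pa).
have b1 := pbn_ext (fun x l => exists l', l1 x = l ++ l') (pc_pbn p1).
have b2 := pbn_ext (fun x l => exists l', l1 x = l ++ l') (pc_pbn p2).
apply: pbn_le (pbn_add b1 b2) => -[x l] [/= okx [l' ->]].
rewrite foldl_cons catrevE.
have := dsize_enc_cat eT (rev l) (l2 x); rewrite dsize_enc_rev.
have := dsize_enc_subseq eT (prefix_subseq l l'); lia.
Qed.

Lemma pc_rev (X : dom) (e : env X) (T : eqType) (x0 : T) (eT : T -> data) l :
  pc e (fun x => enc_seq eT (l x)) -> pc e (fun x => enc_seq eT (rev (l x))).
Proof. by move=> pl; apply: (pc_catrev x0 pl (pc_nil _ eT)). Qed.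

Lemma pc_cat (X : dom) (e : env X) (T : eqType) (x0 : T) (eT : T -> data) l1 l2 :
  pc e (fun x => enc_seq eT (l1 x)) -> pc e (fun x => enc_seq eT (l2 x)) ->
  pc e (fun x => enc_seq eT (l1 x ++ l2 x)).
Proof.
move=> p1 p2; apply: eq_pc (pc_catrev x0 (pc_rev x0 p1) p2) => x _.
by rewrite catrevE revK.
Qed.

Lemma pc_map (X : dom) (e : env X) (T U : eqType) (x0 : T) (u0 : U) (eT : T -> data) (eU : U -> data)
    (l : X -> seq T) (g : X -> T -> U) (Y := @ext X T (fun x t => t \in l x)) :
  pc e (fun x => enc_seq eT (l x)) ->
  (forall e' : env Y, lifts (fun y : Y => y.1) e e' ->
     pc e' (fun y => eT y.2) -> pc e' (fun y => eU (g y.1 y.2))) ->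
  pc e (fun x => enc_seq eU [seq g x t | t <- l x]).
Proof.
move=> pl body.
have bT : pbn (fun y : Y => dsize (eT y.2)) by apply: pbn_mem pl.
(* Running the body in one concrete environment bounds the images uniformly over the list elements,
   and hence the size of the whole output list. *)
have bU : pbn (fun y : Y => dsize (eU (g y.1 y.2))).
  have bs : pbn (fun y : Y => dsize (Pair (e y.1) (eT y.2))).
    apply: pbn_le (pbn_add (pbn_add (pbn_ext _ (ev_bounded e)) bT) (pbn_cst _ 1)).
    by move=> y _ /=; lia.
  apply: pc_pbn (body (Env bs) _ _); last exact: pc_snd (pc_env (Env bs)).
  exact: (@lifts_fst _ _ _ _ (Env bs) (fun y => eT y.2)).
suff : pc e (fun x => enc_seq eU (foldl (fun a t => g x t :: a) [::] (l x))).
  move=> /(pc_rev u0); apply: eq_pc => x _.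
  by rewrite foldl_cons_map revK.
apply: (pc_foldl x0 pl (pc_nil _ eU)) => [|e' lift pt pa].
  have [K [d H]] := bU.
  have b1 := pbn_ext (fun x l1 => exists l', l x = l1 ++ l') (pbn_size pl).
  have b2 : pbn (fun y : prefix_dom l => K * (sz y).+1 ^ d + 1)%N.
    by apply: pbn_add (pbn_cst _ _); exists K, d.
  apply: pbn_le (pbn_add (pbn_mul b1 b2) (pbn_cst _ 1)) => -[x l1] [/= okx [l' Hl]].
  rewrite foldl_cons_map dsize_enc_rev enc_seq_map.
  apply: leq_trans (dsize_enc_seq (b := K * (sz x).+1 ^ d) _) _.
    move=> t tl; apply: (H (x, t)); split=> //=.
    by rewrite Hl mem_cat tl.
  by rewrite /= leq_add2r leq_mul ?addn1 // Hl size_cat leq_addr.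
apply: (pc_cons _ pa).
apply: (pc_body bT body lift pt) => -[x [t a]] [/= okx [l1 [l2 [-> _]]]].
by split=> //; rewrite mem_cat mem_head orbT.
Qed.

Lemma pc_flatten (X : dom) (e : env X) (T : eqType) (x0 : T) (eT : T -> data) l :
  pc e (fun x => enc_seq (enc_seq eT) (l x)) ->
  pc e (fun x => enc_seq eT (flatten (l x))).
Proof.
move=> pl.
have E s : foldl (fun (a t : seq T) => catrev t a) [::] s = rev (flatten s).
  rewrite -[RHS]cats0; move: [::] => u; elim: s u => //= s ss IH u.
  by rewrite IH rev_cat -catA catrevE.
suff : pc e (fun x => enc_seq eT (foldl (fun a t => catrev t a) [::] (l x))).
  move=> /(pc_rev x0); apply: eq_pc => x _.
  by rewrite E revK.
apply: (pc_foldl [::] pl (pc_nil _ eT)) => [|e' lift pt pa]; last exact: (pc_catrev x0 pt pa).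
have b1 := pbn_ext (fun x l1 => exists l', l x = l1 ++ l') (pc_pbn pl).
apply: pbn_le b1 => -[x l1] [/= okx [l' ->]].
rewrite E dsize_enc_rev.
have := dsize_enc_subseq (enc_seq eT) (prefix_subseq l1 l').
apply: leq_trans; elim: l1 {x okx l'} => //= s ss.
have := dsize_enc_cat eT s (flatten ss); lia.
Qed.

Lemma pc_has (X : dom) (e : env X) (T : eqType) (x0 : T) (eT : T -> data) (l : X -> seq T)
    (p : X -> pred T) (Y := @ext X T (fun x t => t \in l x)) :
  pc e (fun x => enc_seq eT (l x)) ->
  (forall e' : env Y, lifts (fun y : Y => y.1) e e' ->
     pc e' (fun y => eT y.2) -> pc e' (fun y => Int (Posz (p y.1 y.2)))) ->
  pc e (fun x => Int (Posz (has (p x) (l x)))).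
Proof.
move=> pl body.
have bT : pbn (fun y : Y => dsize (eT y.2)) by apply: pbn_mem pl.
pose eb (b : bool) := Int (Posz b).
suff : pc e (fun x => eb (foldl (fun a t => a || p x t) false (l x))).
  apply: eq_pc => x _; congr eb.
  rewrite -[RHS]orFb; move: false; elim: (l x) => [|t s IH] b /=.
    by rewrite orbF.
  by rewrite IH orbA.
apply: (pc_foldl x0 pl (pc_cst e (Int 0))) => [|e' lift pt pa].
  apply: pbn_le (@pbn_cst _ (dsize (eb false) + dsize (eb true))) => y _.
  by case: (foldl _ _ _); rewrite ?leq_addl ?leq_addr.
apply: (pc_or pa _).
apply: (pc_body bT body lift pt) => -[x [t a]] [/= okx [l1 [l2 [-> _]]]].
by split=> //; rewrite mem_cat mem_head orbT.
Qed.

Lemma pc_not (X : dom) (e : env X) (b : X -> bool) :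
  pc e (fun x => Int (Posz (b x))) -> pc e (fun x => Int (Posz (~~ b x))).
Proof.
move=> pb; apply: eq_pc (pc_sub (pc_cst e (Int 1)) pb) => x _.
by case: (b x).
Qed.

Lemma pc_size (X : dom) (e : env X) (T : eqType) (x0 : T) (eT : T -> data) l :
  pc e (fun x => enc_seq eT (l x)) -> pc e (fun x => Int (Posz (size (l x)))).
Proof.
move=> pl; pose en (k : nat) := Int (Posz k).
have E (s : seq T) : foldl (fun a _ => a.+1) 0%N s = size s.
  by rewrite -[RHS]add0n; move: 0%N; elim: s => [|t s IH] k /=; rewrite ?addn0 ?IH ?addnS.
suff : pc e (fun x => en (foldl (fun a _ => a.+1) 0%N (l x))).
  by apply: eq_pc => x _; rewrite E.
apply: (pc_foldl x0 pl (pc_cst e (Int 0))) => [|e' lift pt pa].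
  have b1 := pbn_ext (fun x l1 => exists l', l x = l1 ++ l') (pbn_size pl).
  apply: pbn_le (pbn_add b1 (pbn_cst _ 1)) => -[x l1] [/= okx [l' ->]].
  rewrite E addn1 ltnS; apply: leq_trans (_ : size l1 <= _)%N.
    by apply: bit_length_le; rewrite ltn_expl.
  by rewrite size_cat leq_addr.
apply: eq_pc (pc_add (pc_cst _ (Int 1)) pa) => y _.
by rewrite /en.
Qed.


(** Total projections, so that they can be applied to a list that may be empty; the empty list
    [Int 0] is then its own tail. *)
Definition dfst (d : data) : data := if d is Pair a _ then a else d.
Definition dsnd (d : data) : data := if d is Pair _ b then b else d.

Lemma pc_dfst (X : dom) (e : env X) f : pc e f -> pc e (fun x => dfst (f x)).
Proof.
move=> pf; have b := pc_pbn pf.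
apply: (pc_prim (Q := If IsPair Fst Id) pf _ (pbn_mul (pbn_cst _ 3) b)) => [|x _].
  by apply: pbn_le b => x _; case: (f x) => //= u v; lia.
rewrite mulSn mulSn mul1n addnA; have := runs_IsPair (f x).
case: (f x) => [a|u v] r.
- exact: runs_IfF r (runs_Id _).
- exact: runs_IfT r _ (runs_Fst _ _).
Qed.

Lemma pc_dsnd (X : dom) (e : env X) f : pc e f -> pc e (fun x => dsnd (f x)).
Proof.
move=> pf; have b := pc_pbn pf.
apply: (pc_prim (Q := If IsPair Snd Id) pf _ (pbn_mul (pbn_cst _ 3) b)) => [|x _].
  by apply: pbn_le b => x _; case: (f x) => //= u v; lia.
rewrite mulSn mulSn mul1n addnA; have := runs_IsPair (f x).
case: (f x) => [a|u v] r.
- exact: runs_IfF r (runs_Id _).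
- exact: runs_IfT r _ (runs_Snd _ _).
Qed.

Lemma pc_behead (X : dom) (e : env X) T (eT : T -> data) l :
  pc e (fun x => enc_seq eT (l x)) -> pc e (fun x => enc_seq eT (behead (l x))).
Proof.
by move=> /pc_dsnd; apply: eq_pc => x _; case: (l x).
Qed.

Lemma pc_nilp (X : dom) (e : env X) T (eT : T -> data) l :
  pc e (fun x => enc_seq eT (l x)) -> pc e (fun x => Int (Posz (nilp (l x)))).
Proof.
move=> pl; apply: eq_pc (pc_not (pc_ispair pl)) => x _.
by case: (l x).
Qed.

Lemma pc_head (X : dom) (e : env X) T (eT : T -> data) x0 l :
  pc e (fun x => enc_seq eT (l x)) -> pc e (fun x => eT (head x0 (l x))).
Proof.
move=> pl; apply: eq_pc (pc_if (pc_nilp pl) (pc_cst _ (eT x0)) (pc_dfst pl)).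
by move=> x _; case: (l x).
Qed.

Definition epair A B (eA : A -> data) (eB : B -> data) (p : A * B) : data :=
  Pair (eA p.1) (eB p.2).

Lemma pc_mk (X : dom) (e : env X) A B (eA : A -> data) (eB : B -> data) f g :
  pc e (fun x => eA (f x)) -> pc e (fun x => eB (g x)) ->
  pc e (fun x => epair eA eB (f x, g x)).
Proof. exact: pc_pair. Qed.

Lemma pc_p1 (X : dom) (e : env X) A B (eA : A -> data) (eB : B -> data) f :
  pc e (fun x => epair eA eB (f x)) -> pc e (fun x => eA (f x).1).
Proof. exact: pc_fst. Qed.

Lemma pc_p2 (X : dom) (e : env X) A B (eA : A -> data) (eB : B -> data) f :
  pc e (fun x => epair eA eB (f x)) -> pc e (fun x => eB (f x).2).
Proof. exact: pc_snd. Qed.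

Lemma mem_zip (S T : eqType) (s : seq S) (t : seq T) p :
  p \in zip s t -> p.1 \in s /\ p.2 \in t.
Proof.
elim: s t => [|x s IH] [|y t] //=; rewrite !inE => /orP[/eqP->|/IH[-> ->]] /=.
- by rewrite !eqxx.
- by rewrite !orbT.
Qed.

Lemma size_zip_le S T (s : seq S) (t : seq T) : (size (zip s t) <= size s)%N.
Proof. by elim: s t => [|x s IH] [|y t] //=; apply: IH. Qed.

Section Zip.
Variables (S T : eqType) (x0 : S) (y0 : T) (eS : S -> data) (eT : T -> data).

Definition zip_step (a : seq T * seq (S * T)) (x : S) : seq T * seq (S * T) :=
  (behead a.1, if nilp a.1 then a.2 else (x, head y0 a.1) :: a.2).

Lemma zip_foldl s t :
  foldl zip_step (t, [::]) s = (drop (size s) t, rev (zip s t)).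
Proof.
rewrite -[rev _]cats0; move: [::] => u.
elim: s t u => [|x s IH] [|y t] u //=.
  by rewrite [zip_step _ _]/= IH; case: (s).
by rewrite [zip_step _ _]/= IH rev_cons cat_rcons.
Qed.

Lemma dsize_zip s t :
  (dsize (enc_seq (epair eS eT) (zip s t)) <=
   size s * (dsize (enc_seq eS s) + dsize (enc_seq eT t) + 2) + 1)%N.
Proof.
apply: leq_trans (dsize_enc_seq (b := dsize (enc_seq eS s) + dsize (enc_seq eT t) + 1) _) _.
  by move=> p /mem_zip[/(dsize_enc_mem eS) + /(dsize_enc_mem eT)] /=; lia.
by rewrite -addnS leq_add2r leq_mul // size_zip_le.
Qed.

Lemma pc_zip (X : dom) (e : env X) s t :
  pc e (fun x => enc_seq eS (s x)) -> pc e (fun x => enc_seq eT (t x)) ->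
  pc e (fun x => enc_seq (epair eS eT) (zip (s x) (t x))).
Proof.
move=> ps pt; pose eA := epair (enc_seq eT) (enc_seq (epair eS eT)).
suff : pc e (fun x => eA (foldl zip_step (t x, [::]) (s x))).
  move=> /pc_p2/(pc_rev (x0, y0)); apply: eq_pc => x _.
  by rewrite zip_foldl revK.
have p0 : pc e (fun x => eA (t x, [::])) by apply: pc_mk pt (pc_nil _ _).
apply: (pc_foldl x0 ps p0) => [|e' lift p1 p2].
  pose Q x l1 := exists l2, s x = l1 ++ l2.
  have b1 : pbn (fun y : ext Q => size (s y.1)) := pbn_ext _ (pbn_size ps).
  have b2 : pbn (fun y : ext Q => dsize (enc_seq eS (s y.1))) := pbn_ext _ (pc_pbn ps).
  have b3 : pbn (fun y : ext Q => dsize (enc_seq eT (t y.1))) := pbn_ext _ (pc_pbn pt).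
  apply: pbn_le (pbn_add (pbn_add b3 (pbn_mul b1 (pbn_add (pbn_add b2 b3) (pbn_cst _ 2)))) (pbn_cst _ 2)).
  move=> -[x l1] [/= okx [l2 sx]].
  rewrite zip_foldl /= dsize_enc_rev.
  have H1 := dsize_enc_subseq eT (drop_subseq (t x) (size l1)).
  have H2 := dsize_zip l1 (t x).
  have H3 : (size l1 * (dsize (enc_seq eS l1) + dsize (enc_seq eT (t x)) + 2) <=
    size (s x) * (dsize (enc_seq eS (s x)) + dsize (enc_seq eT (t x)) + 2))%N.
    rewrite leq_mul ?leq_add2r //; first by rewrite sx size_cat leq_addr.
    by rewrite dsize_enc_subseq // sx prefix_subseq.
  by lia.
have p21 := pc_p1 p2; have p22 := pc_p2 p2.
apply: pc_mk (pc_behead p21) _.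
apply: (pc_if_app (pc_nilp p21) p22).
apply: (pc_cons _ p22); apply: pc_mk p1 (pc_head y0 p21).
Qed.

End Zip.

(** The only comparison of the machine is [Le], so the fold overwrites its answer up to position [k]
    and leaves it alone afterwards. *)
Lemma nth_foldl T (x0 : T) s k :
  foldl (fun (a : nat * T) t => (a.1.+1, if (a.1 <= k)%N then t else a.2)) (0%N, x0) s =
  (size s, last x0 (take k.+1 s)).
Proof.
elim/last_ind: s => //= s t IH; rewrite foldl_rcons IH size_rcons /=.
congr (_, _); case: leqP => h.
  by rewrite take_oversize ?size_rcons ?last_rcons.
by rewrite -cats1 takel_cat.
Qed.

Lemma pc_nth (X : dom) (e : env X) (T : eqType) (eT : T -> data) x0 l k :
  (forall x, ok x -> (k x < size (l x))%N) ->
  pc e (fun x => enc_seq eT (l x)) -> pc e (fun x => Int (Posz (k x))) ->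
  pc e (fun x => eT (nth x0 (l x) (k x))).
Proof.
move=> Hk pl pk; pose en (k : nat) := Int (Posz k).
pose eA := epair en eT.
suff : pc e (fun x => eA (foldl (fun (a : nat * T) t =>
    (a.1.+1, if (a.1 <= k x)%N then t else a.2)) (0%N, x0) (l x))).
  move=> /pc_p2; apply: eq_pc => x /Hk kx.
  by rewrite nth_foldl (take_nth x0) //= last_rcons.
have p0 : pc e (fun x => eA (0%N, x0)) by apply: pc_cst.
apply: (pc_foldl x0 pl p0) => [|e' lift pt pa].
  pose Q x l1 := exists l2, l x = l1 ++ l2.
  have b1 : pbn (fun y : ext Q => size (l y.1)) := pbn_ext _ (pbn_size pl).
  have b2 : pbn (fun y : ext Q => dsize (enc_seq eT (l y.1))) := pbn_ext _ (pc_pbn pl).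
  apply: pbn_le (pbn_add (pbn_add b1 b2) (pbn_cst _ (dsize (eT x0) + 2))) => -[x l1] [/= okx [l2 lx]].
  rewrite nth_foldl /=.
  have H1 : (bit_length (size l1) <= size (l x))%N.
    apply: leq_trans (_ : size l1 <= _)%N; first by apply: bit_length_le; rewrite ltn_expl.
    by rewrite lx size_cat leq_addr.
  have : last x0 (take (k x).+1 l1) \in x0 :: l x.
    have := mem_last x0 (take (k x).+1 l1); rewrite !inE => /orP[->//|].
    by move=> /mem_take; rewrite lx mem_cat => ->; rewrite orbT.
  rewrite inE => /orP[/eqP->|/(dsize_enc_mem eT)]; lia.
have pa1 := pc_p1 pa; have pa2 := pc_p2 pa.
apply: pc_mk; first by apply: eq_pc (pc_add (pc_cst _ (Int 1)) pa1).
by apply: (pc_if_app (pc_le pa1 (lift _ pk)) pt pa2).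
Qed.

(** [N x] is read in binary, so a short encoding does not limit the number of rounds; [pbn N] does.
    Counting down lets the list be built by consing at its front. *)
Lemma pc_iota (X : dom) (e : env X) (N : X -> nat) :
  pc e (fun x => Int (Posz (N x))) -> pbn N ->
  pc e (fun x => enc_seq (fun k => Int (Posz k)) (iota 0 (N x))).
Proof.
move=> pN bN; pose en (k : nat) := Int (Posz k).
pose st x k := Pair (en (N x - k)%N) (enc_seq en (iota (N x - k) k)).
have bst (Q : X -> nat -> Prop) : (forall x k, Q x k -> (k <= N x)%N) ->
    pbn (fun y : ext Q => dsize (st y.1 y.2)).
  move=> HQ; have b1 : pbn (fun y : ext Q => N y.1) := pbn_ext Q bN.
  apply: pbn_le (pbn_add (pbn_add (pbn_mul b1 (pbn_add b1 (pbn_cst _ 3))) b1) (pbn_cst _ 4)).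
  move=> -[x k] [/= okx /HQ kN].
  have H i : (i <= N x)%N -> (bit_length i <= N x)%N.
    move=> iN; apply: bit_length_le; apply: leq_ltn_trans iN _.
    by rewrite ltn_expl.
  have := dsize_enc_seq (f := en) (s := iota (N x - k) k) (b := N x + 1).
  have H' : forall i, i \in iota (N x - k) k -> (dsize (en i) <= N x + 1)%N.
    by move=> i; rewrite mem_iota /= => ik; rewrite addn1 ltnS H //; lia.
  move=> /(_ H'); rewrite size_iota.
  have := H (N x - k)%N (leq_subr _ _).
  have : (k * (N x + 1).+1 <= N x * (N x + 3))%N by rewrite leq_mul //; lia.
  by rewrite /st /=; lia.
have p0 : pc e (fun x => st x 0%N).
  apply: pc_pair; last exact: pc_nil.
  by apply: eq_pc pN => x _; rewrite subn0.
have bY := bst (fun x k => (k <= N x)%N) (fun _ _ => id).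
have bZ := bst (fun x k => (k < N x)%N) (fun _ _ => @ltnW _ _).
have : pc e (fun x => st x (N x)).
  apply: (pc_loop bN (bst := bY) (bst' := bZ) p0).
  - have p1 : pc (Env bY) (fun y => Int (Posz (N y.1 - y.2)%N)) := pc_fst (pc_env (Env bY)).
    apply: eq_pc (pc_not (pc_le p1 (pc_cst _ (Int 0)))) => -[x k] [/= _ kN].
    by congr (Int (Posz (nat_of_bool _))); lia.
  - have p1 : pc (Env bZ) (fun y => Int (Posz (N y.1 - y.2)%N)) := pc_fst (pc_env (Env bZ)).
    have p2 : pc (Env bZ) (fun y => enc_seq en (iota (N y.1 - y.2) y.2)) := pc_snd (pc_env (Env bZ)).
    have p3 : pc (Env bZ) (fun y => Int (Posz (N y.1 - y.2.+1)%N)).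
      apply: eq_pc (pc_sub p1 (pc_cst _ (Int 1))) => -[x k] [/= _ kN].
      by congr Int; lia.
    apply: eq_pc (pc_pair p3 (pc_cons (eT := en) p3 p2)) => -[x k] [/= _ kN].
    by rewrite /st /=; congr (Pair _ (Pair _ (enc_seq _ (iota _ _)))); lia.
move=> /pc_snd; apply: eq_pc => x _.
by rewrite subnn.
Qed.

Lemma pc_foldr (X : dom) (e : env X) (T : eqType) (A : Type) (eT : T -> data)
    (eA : A -> data) (l : X -> seq T) (a0 : X -> A) (f : X -> T -> A -> A) (x0 : T)
    (Y := @ext X (seq T) (fun x l2 => exists l1, l x = l1 ++ l2))
    (Z := @ext X (T * A)%type (fun x ta => exists l1 l2,
       l x = l1 ++ ta.1 :: l2 /\ ta.2 = foldr (f x) (a0 x) l2)) :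
  pc e (fun x => enc_seq eT (l x)) -> pc e (fun x => eA (a0 x)) ->
  pbn (fun y : Y => dsize (eA (foldr (f y.1) (a0 y.1) y.2))) ->
  (forall e' : env Z, lifts (fun y : Z => y.1) e e' ->
     pc e' (fun y => eT y.2.1) -> pc e' (fun y => eA y.2.2) ->
     pc e' (fun y => eA (f y.1 y.2.1 y.2.2))) ->
  pc e (fun x => eA (foldr (f x) (a0 x) (l x))).
Proof.
move=> pl pa bA body.
suff : pc e (fun x => eA (foldl (fun a t => f x t a) (a0 x) (rev (l x)))).
  by apply: eq_pc => x _; rewrite foldl_rev.
have bTA : pbn (fun y : Z => dsize (epair eT eA y.2)).
  have b1 : pbn (fun y : Z => dsize (enc_seq eT (l y.1))) := pbn_ext _ (pc_pbn pl).
  have b2 : pbn (fun y : Z => dsize (eA y.2.2)).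
    have [K [d H]] := bA; exists K, d => -[x [t a]] [/= okx [l1 [l2 [ll ->]]]].
    by apply: (H (x, l2)); split=> //=; exists (rcons l1 t); rewrite cat_rcons.
  apply: pbn_le (pbn_add (pbn_add b1 b2) (pbn_cst _ 1)) => -[x [t a]] [/= okx [l1 [l2 [ll _]]]].
  have : t \in l x by rewrite ll mem_cat mem_head orbT.
  by move=> /(dsize_enc_mem eT); lia.
apply: (pc_foldl x0 (pc_rev x0 pl) pa) => [|e' lift p1 p2].
  have [K [d H]] := bA; exists K, d => -[x l1] [/= okx [l2 ll]].
  rewrite -[l1]revK foldl_rev; apply: (H (x, rev l1)); split=> //=.
  by exists (rev l2); rewrite -rev_cat -ll revK.
pose g (y : Z) := eA (f y.1 y.2.1 y.2.2).
have bg e'' : lifts (fun y : Z => y.1) e e'' -> pc e'' (fun y => epair eT eA y.2) -> pc e'' g.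
  by move=> lift'' p; apply: body => //; [exact: pc_p1 p|exact: pc_p2 p].
have p12 : pc e' (fun y => epair eT eA y.2) by exact: pc_pair p1 p2.
apply: (pc_body bTA bg lift p12) => -[x [t a]] [/= okx [l1 [l2 [ll ->]]]]; split=> //.
exists (rev l2), (rev l1); split.
  by rewrite -[l x]revK ll rev_cat rev_cons cat_rcons.
by rewrite -[l1]revK foldl_rev revK.
Qed.

(** * The pruned dynamic program and the search *)

(** A partial outcome on the items processed so far, with the numerators of its probabilities under
    the listed actions. A column holds the numerators and denominators of one item. *)
Definition state := (seq bool * seq int)%type.
Definition column := seq (int * int).

Definition scale_by (b : bool) (c : column) (ws : seq int) : seq int :=
  [seq p.1 * (if b then p.2.1 else p.2.2 - p.2.1) | p <- zip ws c].

Definition branch (c : column) (sts : seq state) : seq state :=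
  [seq (false :: s.1, scale_by false c s.2) | s <- sts] ++
  [seq (true :: s.1, scale_by true c s.2) | s <- sts].

(** Cross-multiplied form of [a_k / a_0 <= (1 + 1/H) * (b_k / b_0)] for all [k], where index 0 is
    the incentivized action. The universal quantifier is written through [has] to match [pc_has]. *)
Definition dominates (H : nat) (a b : state) : bool :=
  ~~ has (fun p => ~~ (H%:Z * p.1 * head 0 b.2 <= H.+1%:Z * p.2 * head 0 a.2))
         (zip a.2 b.2).

(** The test on the head removes states that are impossible under the incentivized action. *)
Definition insert (H : nat) (kept : seq state) (s : state) : seq state :=
  if (head 0 s.2 <= 0) || has (fun a => dominates H a s) kept then kept
  else s :: kept.

Definition prune (H : nat) (l : seq state) : seq state := foldl (insert H) [::] l.

Definition states (n H : nat) (cols : seq column) : seq state :=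
  foldr (fun c sts => prune H (branch c sts)) [:: ([::], nseq n.+1 1)] cols.

Definition denoms (n : nat) (cols : seq column) : seq int :=
  foldr (fun c ds => [seq p.1 * p.2.2 | p <- zip ds c]) (nseq n.+1 1) cols.

(* Payments are [payment_num / H ^ 2]; the numerator is 1 modulo [H], so this
   fraction is in lowest terms and no gcd has to be computed. *)
Definition payment_num (H : nat) (Ds ws : seq int) (g : nat) : int :=
  (g%:Z * head 0 Ds %/ head 0 ws)%Z * H%:Z + 1.

(** The target expected payment under [a_i] is [g / H], and [g] up to [2 * H] reaches the cap 2.
    Besides the entry, an option stores its contribution to the expected payment of each action,
    again as numerators. *)
Definition options (H : nat) (Ds : seq int) (sts : seq state) :
    seq (seq bool * (int * int) * seq int) :=
  flatten [seq [seq ((s.1, (payment_num H Ds s.2 g, H%:Z * H%:Z)),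
                     [seq w * payment_num H Ds s.2 g | w <- s.2])
               | g <- iota 0 (2 * H).+1] | s <- sts].

Definition cand := (seq (seq bool * (int * int)) * seq int)%type.

(** A candidate may also stay as it is, so [t] rounds produce all selections of at most [t]
    options. *)
Definition extend (opts : seq (seq bool * (int * int) * seq int))
    (cs : seq cand) : seq cand :=
  flatten [seq c :: [seq (o.1 :: c.1, [seq p.1 + p.2 | p <- zip c.2 o.2])
                    | o <- opts] | c <- cs].

Definition cands (n t : nat) opts : seq cand :=
  iter t (extend opts) [:: ([::], nseq n.+1 0)].

(** The inequality of [ic_testP] cleared of all denominators; expected payments have denominator
    [D * H^2], and the components of [q] belong to the competing action. *)
Definition ic_test (H : nat) (delta : int * int) (P D : int) (c : int * int)
    (q : int * int * (int * int)) : bool :=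
  q.1.1 * D * c.2 * q.2.2 * delta.2 + c.1 * (H%:Z * H%:Z) * D * q.1.2 * q.2.2 * delta.2 <=
  P * q.1.2 * c.2 * q.2.2 * delta.2 + q.2.1 * (H%:Z * H%:Z) * D * q.1.2 * c.2 * delta.2
  + delta.1 * (H%:Z * H%:Z) * D * q.1.2 * c.2 * q.2.2.

(** The cap 2 makes an acceptable candidate at least as cheap as any contract that pays more than 2,
    so only contracts within the cap need to be approximated. *)
Definition acceptable (H : nat) (delta : int * int) (Ds : seq int)
    (costs : seq (int * int)) (c : cand) : bool :=
  (head 0 c.2 <= 2%:Z * head 0 Ds * (H%:Z * H%:Z)) &&
  ~~ has (fun q => ~~ ic_test H delta (head 0 c.2) (head 0 Ds) (head (0, 0) costs) q)
         (zip (zip c.2 Ds) costs).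

(** Comparing numerators is enough, since the payments of all candidates under [a_i] share one
    denominator. *)
Definition better (P : cand -> bool) (best : option cand) (c : cand) : option cand :=
  if P c && (if best is Some b then head 0 c.2 <= head 0 b.2 else true)
  then Some c else best.

Definition select (P : cand -> bool) (cs : seq cand) : option cand :=
  foldl (better P) None cs.

(** * Running time of the dynamic program and of the search *)

Definition eZ (a : int) : data := Int a.
Definition eN (k : nat) : data := Int (Posz k).
Definition eB (b : bool) : data := Int (Posz b).
Definition eQ := epair eZ eZ.
Definition eState := epair (enc_seq eB) (enc_seq eZ).
Definition eEntry := epair (enc_seq eB) eQ.
Definition eOption := epair eEntry (enc_seq eZ).
Definition eCand := epair (enc_seq eEntry) (enc_seq eZ).
Definition eBest (o : option cand) : data :=
  if o is Some c then Pair (Int 1) (eCand c) else Int 0.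

Lemma pc_scale_by (X : dom) (e : env X) b c ws :
  pc e (fun x => enc_seq eQ (c x)) -> pc e (fun x => enc_seq eZ (ws x)) ->
  pc e (fun x => enc_seq eZ (scale_by b (c x) (ws x))).
Proof.
move=> pcol pws; apply: (pc_map (0, (0, 0)) 0 (pc_zip 0 (0, 0) pws pcol)).
move=> e' lift p; have p2 := pc_p2 p.
apply: (pc_mul (pc_p1 p)); case: b; first exact: (pc_p1 p2).
exact: (pc_sub (pc_p2 p2) (pc_p1 p2)).
Qed.

Lemma pc_branch (X : dom) (e : env X) c sts :
  pc e (fun x => enc_seq eQ (c x)) -> pc e (fun x => enc_seq eState (sts x)) ->
  pc e (fun x => enc_seq eState (branch (c x) (sts x))).
Proof.
move=> pcol psts.
have half b : pc e (fun x => enc_seq eState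
    [seq (b :: s.1, scale_by b (c x) s.2) | s <- sts x]).
  apply: (pc_map ([::], [::]) ([::], [::]) psts) => e' lift p.
  have pb : pc e' (fun=> eB b) by exact: pc_cst.
  exact: (pc_mk (pc_cons pb (pc_p1 p)) (pc_scale_by b (lift _ pcol) (pc_p2 p))).
exact: (pc_cat ([::], [::]) (half false) (half true)).
Qed.

Lemma pc_dominates (X : dom) (e : env X) H a b :
  pc e (fun x => eN (H x)) -> pc e (fun x => eState (a x)) ->
  pc e (fun x => eState (b x)) ->
  pc e (fun x => eB (dominates (H x) (a x) (b x))).
Proof.
move=> pH pa pb; apply: pc_not.
apply: (pc_has (0, 0) (pc_zip 0 0 (pc_p2 pa) (pc_p2 pb))) => e' lift p.
have pH' := lift _ pH.
have pSH : pc e' (fun y => eN (H y.1).+1).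
  by apply: eq_pc (pc_add (pc_cst _ (Int 1)) pH').
apply: pc_not; apply: pc_le.
- exact: (pc_mul (pc_mul pH' (pc_p1 p)) (lift _ (pc_head 0 (pc_p2 pb)))).
- exact: (pc_mul (pc_mul pSH (pc_p2 p)) (lift _ (pc_head 0 (pc_p2 pa)))).
Qed.

Lemma pc_insert (X : dom) (e : env X) H kept s :
  pc e (fun x => eN (H x)) -> pc e (fun x => enc_seq eState (kept x)) ->
  pc e (fun x => eState (s x)) ->
  pc e (fun x => enc_seq eState (insert (H x) (kept x) (s x))).
Proof.
move=> pH pk ps; apply: (pc_if_app _ pk (pc_cons ps pk)); apply: pc_or.
  exact: (pc_le (pc_head 0 (pc_p2 ps)) (pc_cst _ (Int 0))).
apply: (pc_has ([::], [::]) pk) => e' lift p.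
exact: (pc_dominates (lift _ pH) p (lift _ ps)).
Qed.

Lemma prune_rcons H l s : prune H (rcons l s) = insert H (prune H l) s.
Proof. exact: foldl_rcons. Qed.

Lemma prune_subseq H l : subseq (prune H l) (rev l).
Proof.
elim/last_ind: l => // l s IH; rewrite prune_rcons rev_rcons /insert.
case: ifP => _ /=; last by rewrite eqxx.
exact: subseq_trans IH (subseq_cons _ _).
Qed.

Lemma pc_prune (X : dom) (e : env X) H l :
  pc e (fun x => eN (H x)) -> pc e (fun x => enc_seq eState (l x)) ->
  pc e (fun x => enc_seq eState (prune (H x) (l x))).
Proof.
move=> pH pl.
apply: (pc_foldl (f := fun x => insert (H x)) ([::], [::]) pl (pc_nil _ _)) =>
  [|e' lift p1 p2].
  have b1 := pbn_ext (fun x l1 => exists l', l x = l1 ++ l') (pc_pbn pl).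
  apply: pbn_le b1 => -[x l1] [/= okx [l' ->]].
  apply: leq_trans (dsize_enc_subseq _ (prune_subseq (H x) l1)) _.
  by rewrite dsize_enc_rev dsize_enc_subseq // prefix_subseq.
exact: (pc_insert (lift _ pH) p2 p1).
Qed.

(** The size bound on intermediate state lists depends on the counting argument for pruned lists, so
    it is left as a hypothesis here and discharged in [pc_sts]. *)
Lemma pc_states (X : dom) (e : env X) n H cols :
  pc e (fun x => eN (H x)) -> pc e (fun x => enc_seq (enc_seq eQ) (cols x)) ->
  pbn (fun y : @ext X (seq column) (fun x l2 => exists l1, cols x = l1 ++ l2) =>
         dsize (enc_seq eState (states n (H y.1) y.2))) ->
  pc e (fun x => enc_seq eState (states n (H x) (cols x))).
Proof.
move=> pH pcols bst.
apply: (pc_foldr (f := fun x c sts => prune (H x) (branch c sts)) [::] pcols _ bst).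
  exact: (pc_cst _ (enc_seq eState [:: ([::], nseq n.+1 1)])).
move=> e' lift p1 p2; apply: (pc_prune (lift _ pH)).
exact: (pc_branch p1 p2).
Qed.

Lemma pc_denoms (X : dom) (e : env X) n cols :
  pc e (fun x => enc_seq (enc_seq eQ) (cols x)) ->
  pbn (fun y : @ext X (seq column) (fun x l2 => exists l1, cols x = l1 ++ l2) =>
         dsize (enc_seq eZ (denoms n y.2))) ->
  pc e (fun x => enc_seq eZ (denoms n (cols x))).
Proof.
move=> pcols bst.
apply: (pc_foldr (f := fun x (c : column) (ds : seq int) =>
   [seq p.1 * p.2.2 | p <- zip ds c]) [::] pcols _ bst).
  exact: (pc_cst _ (enc_seq eZ (nseq n.+1 1))).
move=> e' lift p1 p2.
apply: (pc_map (0, (0, 0)) 0 (pc_zip 0 (0, 0) p2 p1)) => e'' lift' p.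
exact: (pc_mul (pc_p1 p) (pc_p2 (pc_p2 p))).
Qed.

Lemma pc_options (X : dom) (e : env X) H Ds sts :
  pc e (fun x => eN (H x)) -> pbn H -> pc e (fun x => enc_seq eZ (Ds x)) ->
  pc e (fun x => enc_seq eState (sts x)) ->
  pc e (fun x => enc_seq eOption (options (H x) (Ds x) (sts x))).
Proof.
move=> pH bH pD psts; apply: (pc_flatten (([::], (0, 0)), [::])).
have pio : pc e (fun x => enc_seq eN (iota 0 (2 * H x).+1)).
  apply: pc_iota.
    by apply: eq_pc (pc_add (pc_cst _ (Int 1)) (pc_add pH pH)) => x _; congr Int; lia.
  by apply: pbn_le (pbn_add (pbn_mul (pbn_cst _ 2) bH) (pbn_cst _ 1)) => x _; lia.
apply: (pc_map ([::], [::]) [::] psts) => e1 lift1 ps.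
apply: (pc_map 0%N (([::], (0, 0)), [::]) (lift1 _ pio)) => e2 lift2 pg.
have pH2 := lift2 _ (lift1 _ pH); have ps2 := lift2 _ ps.
have pD2 := lift2 _ (lift1 _ (pc_head 0 pD)).
have ppay : pc e2 (fun y => eZ (payment_num (H y.1.1) (Ds y.1.1) y.1.2.2 y.2)).
  have pw := pc_head 0 (pc_p2 ps2).
  exact: (pc_add (pc_mul (pc_div (pc_mul pg pD2) pw) pH2) (pc_cst _ (Int 1))).
apply: pc_mk (pc_mk (pc_p1 ps2) (pc_mk ppay (pc_mul pH2 pH2))) _.
apply: (pc_map 0 0 (pc_p2 ps2)) => e3 lift3 pw.
exact: (pc_mul pw (lift3 _ ppay)).
Qed.

Lemma pc_extend (X : dom) (e : env X) opts cs :
  pc e (fun x => enc_seq eOption (opts x)) -> pc e (fun x => enc_seq eCand (cs x)) ->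
  pc e (fun x => enc_seq eCand (extend (opts x) (cs x))).
Proof.
move=> po pcs; apply: (pc_flatten ([::], [::])).
apply: (pc_map ([::], [::]) [::] pcs) => e1 lift1 p1.
apply: (pc_cons p1).
apply: (pc_map (([::], (0, 0)), [::]) ([::], [::]) (lift1 _ po)) => e2 lift2 p2.
have p12 := lift2 _ p1.
apply: pc_mk (pc_cons (pc_p1 p2) (pc_p1 p12)) _.
apply: (pc_map (0, 0) 0 (pc_zip 0 0 (pc_p2 p12) (pc_p2 p2))) => e3 lift3 p3.
exact: (pc_add (pc_p1 p3) (pc_p2 p3)).
Qed.

(** The number [t] of rounds is fixed in advance, so the program is a [t]-fold composition and not a
    loop. The degree of its bound may grow with [t], which is where a constant number of actions
    matters. *)
Lemma pc_cands (X : dom) (e : env X) n t opts :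
  pc e (fun x => enc_seq eOption (opts x)) ->
  pc e (fun x => enc_seq eCand (cands n t (opts x))).
Proof.
move=> po; rewrite /cands; elim: t => [|t IH].
  exact: (pc_cst _ (enc_seq eCand [:: ([::], nseq n.+1 0)])).
exact: (pc_extend po IH).
Qed.

Lemma pc_acceptable (X : dom) (e : env X) H delta Ds costs c :
  pc e (fun x => eN (H x)) -> pc e (fun x => eQ (delta x)) ->
  pc e (fun x => enc_seq eZ (Ds x)) -> pc e (fun x => enc_seq eQ (costs x)) ->
  pc e (fun x => eCand (c x)) ->
  pc e (fun x => eB (acceptable (H x) (delta x) (Ds x) (costs x) (c x))).
Proof.
move=> pH pd pD pco pca; have pP := pc_head 0 (pc_p2 pca).
have pD0 := pc_head 0 pD; have pHH := pc_mul pH pH.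
apply: pc_and.
  exact: (pc_le pP (pc_mul (pc_mul (pc_cst _ (Int 2)) pD0) pHH)).
apply: pc_not.
apply: (pc_has ((0, 0), (0, 0))
  (pc_zip (0, 0) (0, 0) (pc_zip 0 0 (pc_p2 pca) pD) pco)) => e' lift p.
apply: pc_not.
have P1 := lift _ pP; have D1 := lift _ pD0; have HH := lift _ pHH.
have C1 := lift _ (pc_head (0, 0) pco); have d1 := lift _ pd.
have P2 := pc_p1 (pc_p1 p); have D2 := pc_p2 (pc_p1 p); have C2 := pc_p2 p.
have C11 := pc_p1 C1; have C12 := pc_p2 C1.
have C21 := pc_p1 C2; have C22 := pc_p2 C2.
have d11 := pc_p1 d1; have d12 := pc_p2 d1.
apply: pc_le.
- exact: (pc_add (pc_mul (pc_mul (pc_mul (pc_mul P2 D1) C12) C22) d12)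
    (pc_mul (pc_mul (pc_mul (pc_mul (pc_mul C11 HH) D1) D2) C22) d12)).
- exact: (pc_add (pc_add (pc_mul (pc_mul (pc_mul (pc_mul P1 D2) C12) C22) d12)
    (pc_mul (pc_mul (pc_mul (pc_mul (pc_mul C21 HH) D1) D2) C12) d12))
    (pc_mul (pc_mul (pc_mul (pc_mul (pc_mul d11 HH) D1) D2) C12) C22)).
Qed.

Lemma select_mem (P : pred cand) cs c : select P cs = Some c -> c \in cs /\ P c.
Proof.
rewrite /select; elim/last_ind: cs => // cs x IH; rewrite foldl_rcons {1}/better.
case: ifP => [/andP[Px _] [<-]|_ /IH[ccs Pc]]; rewrite mem_rcons inE ?eqxx //.
by rewrite ccs orbT.
Qed.

Lemma select_min (P : pred cand) cs c :
  c \in cs -> P c -> exists2 b, select P cs = Some b & head 0 b.2 <= head 0 c.2.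
Proof.
rewrite /select; elim/last_ind: cs => // cs x IH; rewrite mem_rcons inE.
rewrite foldl_rcons {1}/better => /orP[/eqP <-|ccs] Pc.
  case: foldl => [b|]; rewrite Pc /=; last by exists c.
  by case: leP => h; [exists c|exists b => //; apply: ltW].
have [b -> bc] := IH ccs Pc.
by case: ifP => [/andP[_ xb]|_]; [exists x => //; apply: le_trans xb bc|exists b].
Qed.

Lemma pc_select (X : dom) (e : env X) (P : X -> cand -> bool) cs
    (Y := @ext X cand (fun x t => t \in cs x)) :
  pc e (fun x => enc_seq eCand (cs x)) ->
  (forall e' : env Y, lifts (fun y : Y => y.1) e e' ->
     pc e' (fun y => eCand y.2) -> pc e' (fun y => eB (P y.1 y.2))) ->
  pc e (fun x => eBest (select (P x) (cs x))).
Proof.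
move=> pcs body.
have bT : pbn (fun y : Y => dsize (eCand y.2)) by apply: pbn_mem pcs.
apply: (pc_foldl (f := fun x => better (P x)) ([::], [::]) pcs (pc_cst _ (Int 0))) =>
  [|e' lift p1 p2].
  have b1 := pbn_ext (fun x l1 => exists l', cs x = l1 ++ l') (pc_pbn pcs).
  apply: pbn_le (pbn_add b1 (pbn_cst _ (1 + dsize (Int 1) + dsize (Int 0))%N)).
  move=> -[x l1] [/= okx [l' ->]].
  case E: (foldl _ _ _) => [c|] /=; last lia.
  have [/(dsize_enc_mem eCand) Hc _] := select_mem (E : select (P x) l1 = Some c).
  have := dsize_enc_subseq eCand (prefix_subseq l1 l').
  by move: Hc; rewrite /eCand /=; lia.
have pP : pc e' (fun y => eB (P y.1 y.2.1)).
  apply: (pc_body bT body lift p1) => -[x [t a]] [/= okx [l1 [l2 [-> _]]]].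
  by split=> //; rewrite mem_cat mem_head orbT.
have ps : pc e' (fun y => eBest (Some y.2.1)) := pc_pair (pc_cst _ (Int 1)) p1.
rewrite /better; apply: (pc_if_app (h := eBest) _ ps p2).
apply: (pc_and pP).
have q1 := pc_head 0 (pc_p2 p1).
have q3 := pc_dsnd (pc_dsnd p2).
have q2 : pc e' (fun y => eZ (if y.2.2 is Some b then head 0 b.2 else 0)).
  have := pc_if (pc_ispair q3) (pc_dfst q3) (pc_cst _ (Int 0)).
  by apply: eq_pc => -[x [t [[a [|w ws]]|]]] _.
apply: eq_pc (pc_if (pc_ispair p2) (pc_le q1 q2) (pc_cst _ (Int 1))).
by move=> [x [t [b|]]].
Qed.

(** * Pruning *)

Lemma dominatesP H a b : size a.2 = size b.2 ->
  reflect (forall p, (p < size a.2)%N ->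
     H%:Z * nth 0 a.2 p * nth 0 b.2 0 <= H.+1%:Z * nth 0 b.2 p * nth 0 a.2 0)
    (dominates H a b).
Proof.
move=> sab; rewrite /dominates -all_predC !nth0.
apply: (iffP (all_nthP (0, 0))) => dom p; have := dom p;
  rewrite size_zip sab minnn nth_zip //=.
- by move=> + plt => /(_ plt)/negPn.
- by move=> + plt => /(_ plt) ->.
Qed.

Lemma dominates_refl H s : all (fun w => 0 <= w) s.2 -> dominates H s s.
Proof.
move=> /(all_nthP 0) s_ge0; apply/dominatesP => // p plt.
have := s_ge0 _ plt; have := s_ge0 _ (leq_ltn_trans (leq0n p) plt).
move: (nth 0 s.2 0) (nth 0 s.2 p) => a b a0 b0.
by rewrite -!mulrA ler_wpM2r ?mulr_ge0 // lez_nat.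
Qed.

Lemma prune_mem H l s : s \in prune H l -> s \in l.
Proof. by move=> /(mem_subseq (prune_subseq H l)); rewrite mem_rev. Qed.

Lemma prune_gt0 H l s : s \in prune H l -> 0 < nth 0 s.2 0.
Proof.
elim/last_ind: l => // l t IH; rewrite prune_rcons /insert.
case: ifP => // /norP[t0 _]; rewrite inE => /orP[/eqP->|//].
by rewrite nth0 ltNge.
Qed.

(** New states go to the front, so the states further down the list are those already present when a
    state was tested. *)
Lemma prune_pairwise H l : pairwise (fun s a => ~~ dominates H a s) (prune H l).
Proof.
elim/last_ind: l => // l t IH; rewrite prune_rcons /insert.
by case: ifP => // /norP[_ /hasPn/allP]; rewrite /= IH andbT.
Qed.

(** A state of positive head weight is rejected only because a kept state dominates it, and kept
    states are never removed. Nonnegativity makes a kept state dominate itself. *)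
Lemma prune_dominates H l t :
  (forall s, s \in l -> all (fun w => 0 <= w) s.2) -> t \in l ->
  0 < nth 0 t.2 0 -> exists2 a, a \in prune H l & dominates H a t.
Proof.
move=> l_ge0 + t_gt0; elim/last_ind: l l_ge0 => // l s IH l_ge0.
rewrite mem_rcons inE prune_rcons => /orP[/eqP ts|tl].
  rewrite /insert -nth0 -ts leNgt t_gt0 /=.
  case: hasP => [[a al dom]|_]; first by exists a.
  exists t; rewrite ?mem_head //; apply: dominates_refl.
  by rewrite ts; apply: l_ge0; rewrite mem_rcons mem_head.
have [|a al dom] := IH _ tl.
  by move=> u ul; apply: l_ge0; rewrite mem_rcons inE ul orbT.
exists a => //; rewrite /insert; case: ifP => // _.
by rewrite inE al orbT.
Qed.

(** This is [(1 + 1/H) ^ H >= 2], obtained from Bernoulli's inequality in integer form. *)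
Lemma double_le_expS H : (0 < H)%N -> (2 * H ^ H <= H.+1 ^ H)%N.
Proof.
move=> H_gt0.
have bernoulli k : (H ^ k * (H + k) <= H * H.+1 ^ k)%N.
  elim: k => [|k IH]; first by rewrite mul1n muln1 addn0.
  rewrite !expnS; have := leq_mul (leqnn H.+1) IH.
  by move: (H ^ k)%N (H.+1 ^ k)%N => u v; nia.
rewrite -(leq_pmul2l H_gt0); apply: leq_trans (bernoulli H).
by move: (H ^ H)%N => u; lia.
Qed.

(* Number of the cell of the geometric grid with ratio [1 + 1/H] that contains
   [2 ^ L * w / w0]; cell 0 is for [w = 0]. *)
Definition cell (L H w0 w : nat) : nat :=
  find (fun t => w * 2 ^ L * H ^ t < H.+1 ^ t * w0)%N (iota 0 (2 * L * H).+2).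

Section Cells.
Variables (L H : nat) (H_gt0 : (0 < H)%N).

(** The scaled ratio [2 ^ L * w / w0] is at most [2 ^ (2 * L)], which [double_le_expS] bounds by
    [(1 + 1/H) ^ (2 * L * H)]. One further step makes the inequality strict, so the search always
    succeeds. *)
Lemma cellP w0 w : (0 < w0 <= 2 ^ L)%N -> (w <= 2 ^ L)%N ->
  [/\ (cell L H w0 w < (2 * L * H).+2)%N,
      (w * 2 ^ L * H ^ cell L H w0 w < H.+1 ^ cell L H w0 w * w0)%N &
      forall t, (t < cell L H w0 w)%N -> (H.+1 ^ t * w0 <= w * 2 ^ L * H ^ t)%N].
Proof.
move=> /andP[w0_gt0 w0_le] w_le.
pose P t := (w * 2 ^ L * H ^ t < H.+1 ^ t * w0)%N.
have hasP : has P (iota 0 (2 * L * H).+2).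
  apply/hasP; exists (2 * L * H).+1; first by rewrite mem_iota; lia.
  have step : (2 ^ (2 * L) * H ^ (2 * L * H) <= H.+1 ^ (2 * L * H))%N.
    rewrite !(mulnC _ H) (expnM H) (expnM H.+1) -expnMn.
    case: (2 * L)%N => // k.
    by rewrite leq_exp2r //; apply: double_le_expS.
  have le1 : (w * 2 ^ L <= 2 ^ (2 * L))%N by rewrite mul2n -addnn expnD leq_mul.
  have [pH pS] : [/\ 0 < H ^ (2 * L * H) & 0 < H.+1 ^ (2 * L * H)]%N.
    by rewrite !expn_gt0 H_gt0.
  rewrite /P !expnS; move: step le1 pH pS.
  move: (H ^ _)%N (H.+1 ^ _)%N (2 ^ (2 * L))%N (w * _)%N => u v x y.
  move=> xu yx u0 v0; apply: (@leq_ltn_trans (H * v)).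
    by rewrite mulnCA leq_mul2l (leq_trans _ xu) ?orbT // leq_mul.
  apply: (@leq_trans (H.+1 * v)); first by rewrite ltn_pmul2r.
  by rewrite -mulnA leq_mul // leq_pmulr.
have lt_cell : (cell L H w0 w < (2 * L * H).+2)%N.
  by rewrite -[X in (_ < X)%N](size_iota 0) -has_find.
split=> //.
- by have := nth_find 0%N hasP; rewrite -/(cell L H w0 w) nth_iota.
- move=> t t_lt; have := before_find 0%N t_lt.
  by rewrite nth_iota ?(ltn_trans t_lt) // add0n => /negbT; rewrite -leqNgt.
Qed.

(** Two ratios in cell [t + 1] both lie between [(1 + 1/H) ^ t] and [(1 + 1/H) ^ (t + 1)], hence
    differ by a factor of at most [1 + 1/H]. Cell 0 forces [a = 0], because [a0 <= 2 ^ L]. *)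
Lemma cell_dominates a0 a b0 b :
  (0 < a0 <= 2 ^ L)%N -> (a <= 2 ^ L)%N -> (0 < b0 <= 2 ^ L)%N -> (b <= 2 ^ L)%N ->
  cell L H a0 a = cell L H b0 b -> (H * a * b0 <= H.+1 * b * a0)%N.
Proof.
move=> a0P aP b0P bP Eab.
have [_ Ha _] := cellP a0P aP; have [_ _] := cellP b0P bP; rewrite -Eab.
move: Ha; case: (cell L H a0 a) => [|t].
  rewrite expn0 mul1n muln1 => a_lt _.
  have /eqP -> : a == 0%N by rewrite -leqn0; case/andP: a0P => _; nia.
  by rewrite muln0 mul0n.
move=> Ha /(_ _ (ltnSn t)) Hb.
have [p2 pH pS] : [/\ 0 < 2 ^ L, 0 < H ^ t & 0 < H.+1 ^ t]%N by rewrite !expn_gt0 H_gt0.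
have c_gt0 : (0 < 2 ^ L * H ^ t * H.+1 ^ t)%N by rewrite !muln_gt0 p2 pH pS.
rewrite -(leq_pmul2r c_gt0).
have := leq_mul (ltnW Ha) Hb; rewrite !expnS.
move: (2 ^ L)%N (H ^ t)%N (H.+1 ^ t)%N => u v w.
by move=> le1; apply: leq_trans (leq_trans _ le1) _; apply/eq_leq; lia.
Qed.
End Cells.

(** Pigeonhole: kept states with equal cells in all coordinates would dominate each other, against
    [prune_pairwise], so [key] is injective on the kept list. The bounds on the weights keep every
    cell number below [M.+1], where [inord] is faithful. *)
Lemma prune_size n L H (l : seq state) : (0 < H)%N ->
  (forall s, s \in l -> size s.2 = n.+1 /\
     all (fun w : int => 0 <= w <= (2 ^ L)%N%:Z) s.2) ->
  (size (prune H l) <= (2 * L * H).+2 ^ n.+1)%N.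
Proof.
move=> H_gt0 l_wf; set M := (2 * L * H).+1.
pose key (s : state) : {ffun 'I_n.+1 -> 'I_M.+1} :=
  [ffun p : 'I_n.+1 => inord (cell L H (absz (nth 0 s.2 0)) (absz (nth 0 s.2 p)))].
have wf s : s \in prune H l -> [/\ size s.2 = n.+1, 0 < nth 0 s.2 0 &
    forall p, (p < n.+1)%N -> 0 <= nth 0 s.2 p <= (2 ^ L)%N%:Z].
  move=> sp; have [sz /(all_nthP 0) bd] := l_wf s (prune_mem sp).
  by split=> //; [apply: prune_gt0 sp|rewrite -sz].
have key_dom a b : a \in prune H l -> b \in prune H l ->
    key a = key b -> dominates H a b.
  move=> /wf[sa a0 aP] /wf[sb b0 bP] /ffunP kab.
  apply/dominatesP; rewrite sa // => p plt.
  have := kab (Ordinal plt); rewrite !ffunE /=.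
  have := aP _ plt; have := bP _ plt; have := aP 0%N isT; have := bP 0%N isT.
  case: (nth 0 a.2 0) a0 => // x x0; case: (nth 0 b.2 0) b0 => // y y0.
  case: (nth 0 a.2 p) => // u; case: (nth 0 b.2 p) => // v.
  rewrite !lez_nat !ltz_nat /= in x0 y0 * => yL xL vL uL.
  have xP : (0 < x <= 2 ^ L)%N by rewrite x0.
  have yP : (0 < y <= 2 ^ L)%N by rewrite y0.
  have [cx _ _] := cellP H_gt0 xP uL; have [cy _ _] := cellP H_gt0 yP vL.
  move=> /(congr1 val); rewrite /= !inordK // => /(cell_dominates H_gt0 xP uL yP vL).
  lia.
rewrite -(size_map key); apply: leq_trans (_ : #|{ffun 'I_n.+1 -> 'I_M.+1}| <= _)%N;
  last by rewrite card_ffun !card_ord.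
suff /card_uniqP <- : uniq [seq key s | s <- prune H l] by apply: max_card.
rewrite uniq_pairwise pairwise_map.
apply: (sub_in_pairwise (P := mem (prune H l))) (prune_pairwise H l);
  last exact/allP.
move=> s a sl al; by apply: contraNneq => /esym; exact: (key_dom a s al sl).
Qed.

(** * Semantics of the states *)

Section Semantics.
Variables (n m : nat) (I : setting rat n m) (i : 'I_n).

(* The incentivized action comes first, so that the programs find its data at
   the head of every list; it occurs twice. *)
Definition acts : seq 'I_n := i :: enum 'I_n.
Arguments acts : simpl never.

Definition num_den (x : rat) : int * int := (numq x, denq x).

Definition item_col (j : 'I_m) : column := [seq num_den (prob I k j) | k <- acts].

Definition factor (k : 'I_n) (j : 'I_m) (b : bool) : int :=
  if b then numq (prob I k j) else denq (prob I k j) - numq (prob I k j).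

Definition weight (js : seq 'I_m) (bits : seq bool) (k : 'I_n) : int :=
  \prod_(p <- zip js bits) factor k p.1 p.2.

Definition denom (js : seq 'I_m) (k : 'I_n) : int := \prod_(j <- js) denq (prob I k j).

Lemma size_acts : size acts = n.+1.
Proof. by rewrite /acts /= size_enum_ord. Qed.

Lemma map_acts_const (T : Type) (c : T) : [seq c | _ <- acts] = nseq n.+1 c.
Proof. by rewrite -size_acts; elim: acts => //= k s ->. Qed.

Lemma scale_by_acts b j (F : 'I_n -> int) :
  scale_by b (item_col j) [seq F k | k <- acts] = [seq F k * factor k j b | k <- acts].
Proof. by rewrite /scale_by /item_col zip_map -map_comp; apply: eq_map => k; case: b. Qed.

Lemma weight_cons j js b bits k :
  weight (j :: js) (b :: bits) k = factor k j b * weight js bits k.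
Proof. by rewrite /weight /= big_cons. Qed.

Lemma denoms_acts js : denoms n [seq item_col j | j <- js] = [seq denom js k | k <- acts].
Proof.
elim: js => [|j js IH].
  by rewrite -[LHS]/(nseq n.+1 1) -map_acts_const; apply: eq_map => k; rewrite /denom big_nil.
rewrite -[LHS]/([seq p.1 * p.2.2 | p <- zip (denoms n [seq item_col j | j <- js]) (item_col j)]).
rewrite IH /item_col zip_map -map_comp.
by apply: eq_map => k /=; rewrite /denom big_cons mulrC.
Qed.

Hypothesis prob01 : forall k j, 0 <= prob I k j <= 1.

Lemma numq_prob k j : 0 <= numq (prob I k j) <= denq (prob I k j).
Proof.
have /andP[p0 p1] := prob01 k j; rewrite numq_ge0 p0 /=.
have := p1; rewrite -[prob I k j]divq_num_den ler_pdivrMr ?ltr0z ?denq_gt0 // mul1r.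
by rewrite ler_int divq_num_den.
Qed.

Lemma factor_bound k j b : 0 <= factor k j b <= denq (prob I k j).
Proof. by have := numq_prob k j; rewrite /factor; case: b; lia. Qed.

Lemma denom_gt0 js k : 0 < denom js k.
Proof. by apply: prodr_gt0 => j _; apply: denq_gt0. Qed.

Lemma weight_bound js bits k : 0 <= weight js bits k <= denom js k.
Proof.
elim: js bits => [|j js IH] [|b bits]; rewrite /weight /denom ?big_nil //=.
  by have := denom_gt0 (j :: js) k; rewrite gtz0_ge1.
rewrite !big_cons; have /andP[f0 f1] := factor_bound k j b.
have /andP[w0 w1] := IH bits.
by rewrite mulr_ge0 //= ler_pM.
Qed.

Lemma states_wf H js s : s \in states n H [seq item_col j | j <- js] ->
  [/\ size s.1 = size js, s.2 = [seq weight js s.1 k | k <- acts] &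
      0 < weight js s.1 i].
Proof.
elim: js s => [|j js IH] s.
  rewrite inE => /eqP ->; split=> //=; last by rewrite /weight big_nil.
  rewrite -[LHS]/(nseq n.+1 1) -map_acts_const.
  by apply: eq_map => k; rewrite /weight big_nil.
rewrite /= -/(states n H [seq item_col j | j <- js]) => sp.
have [sz Es] : size s.1 = (size js).+1 /\
    s.2 = [seq weight (j :: js) s.1 k | k <- acts].
  have expd b u : u \in states n H [seq item_col j | j <- js] ->
      size (b :: u.1) = (size js).+1 /\
      scale_by b (item_col j) u.2 = [seq weight (j :: js) (b :: u.1) k | k <- acts].
    move=> /IH[sz -> _]; rewrite /= sz; split=> //.
    by rewrite scale_by_acts; apply: eq_map => k; rewrite weight_cons mulrC.
  have := prune_mem sp; rewrite mem_cat => /orP[] /mapP[u /expd uP ->];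
    exact: uP.
by split=> //; have := prune_gt0 sp; rewrite Es.
Qed.

Lemma states_size H js L : (0 < H)%N -> 
  (forall k, denom js k <= (2 ^ L)%N%:Z) ->
  (size (states n H [seq item_col j | j <- js]) <= (2 * L * H).+2 ^ n.+1)%N.
Proof.
move=> H_gt0; case: js => [|j js] bd; first by rewrite expn_gt0.
rewrite /=.
apply: prune_size => // s sl.
have [b [u [us ->]]] : exists b u, u \in states n H [seq item_col j | j <- js] /\
    s = (b :: u.1, scale_by b (item_col j) u.2).
  move: sl; rewrite mem_cat => /orP[] /mapP[u us ->].
    by exists false, u.
  by exists true, u.
have [_ -> _] := states_wf us; rewrite scale_by_acts size_map size_acts; split=> //.
apply/allP => _ /mapP[k _ ->]; rewrite mulrC -weight_cons.
have /andP[-> w_le] := weight_bound (j :: js) (b :: u.1) k.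
exact: le_trans w_le (bd k).
Qed.

(** Induction over the items. The representative [s] of the tail, extended by the same bit [b],
    keeps its ratio error because both sides gain the same factor; pruning then replaces this
    extension [t] by some [a] at the price of one more factor [1 + 1/H]. *)
Lemma states_dominate H js bits : (0 < H)%N -> size bits = size js ->
  0 < weight js bits i ->
  exists2 s, s \in states n H [seq item_col j | j <- js] &
    forall k, H%:Z ^+ size js * weight js s.1 k * weight js bits i <=
              H.+1%:Z ^+ size js * weight js bits k * weight js s.1 i.
Proof.
move=> H_gt0; elim: js bits => [|j js IH] [|b bits] //= => [_ _|[/IH{}IH]].
  by exists ([::], nseq n.+1 1); rewrite ?mem_head.
have /andP[fi0 _] := factor_bound i j b; have /andP[wi0 _] := weight_bound js bits i.
rewrite weight_cons => fw_gt0.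
have wi_gt0 : 0 < weight js bits i.
  by rewrite lt_neqAle wi0 andbT; apply: contraTneq fw_gt0 => <-; rewrite mulr0 ltxx.
have fi_gt0 : 0 < factor i j b.
  by rewrite lt_neqAle fi0 andbT; apply: contraTneq fw_gt0 => <-; rewrite mul0r ltxx.
have [s sP sdom] := IH wi_gt0; have [sz Es si_gt0] := states_wf sP.
pose t : state := (b :: s.1, scale_by b (item_col j) s.2).
have Et : t.2 = [seq weight (j :: js) (b :: s.1) k | k <- acts].
  by rewrite /t Es scale_by_acts; apply: eq_map => k; rewrite weight_cons mulrC.
have [|||a aP adom] := @prune_dominates H (branch (item_col j) (states n H [seq item_col j | j <- js])) t.
- have ge0 c v : v \in states n H [seq item_col j | j <- js] ->
      all (fun w => 0 <= w) (scale_by c (item_col j) v.2).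
    move=> /states_wf[_ -> _]; rewrite scale_by_acts.
    apply/allP => _ /mapP[k _ ->]; rewrite mulrC -weight_cons.
    by have /andP[] := weight_bound (j :: js) (c :: v.1) k.
  by move=> u; rewrite mem_cat => /orP[] /mapP[v /ge0 vP ->]; apply: vP.
- by rewrite mem_cat; apply/orP; rewrite /t; case: (b); [right|left]; apply: map_f.
- by rewrite Et /= weight_cons mulr_gt0.
exists a => // k.
have [sza Ea ai_gt0] : [/\ size a.1 = size (j :: js),
   a.2 = [seq weight (j :: js) a.1 k | k <- acts] & 0 < weight (j :: js) a.1 i].
  exact: (@states_wf H (j :: js) a aP).
have : H%:Z * weight (j :: js) a.1 k * weight (j :: js) (b :: s.1) i <=
       H.+1%:Z * weight (j :: js) (b :: s.1) k * weight (j :: js) a.1 i.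
  have szE : size a.2 = size t.2 by rewrite Ea Et !size_map.
  (* Position 0 of [acts] holds [i], so action [k] is found one place after its index in the
     enumeration. *)
  have := dominatesP H szE adom (index k (enum 'I_n)).+1.
  rewrite Ea Et size_map size_acts ltnS.
  have kn : (index k (enum 'I_n) < n)%N by rewrite -[X in (_ < X)%N](size_enum_ord n) index_mem mem_enum.
  have nth_k (F : 'I_n -> int) : nth 0 [seq F k' | k' <- acts] (index k (enum 'I_n)).+1 = F k.
    rewrite /acts map_cons -[LHS]/(nth 0 [seq F k' | k' <- enum 'I_n] (index k (enum 'I_n))).
    by rewrite (nth_map i) ?nth_index ?mem_enum ?size_enum_ord.
  by rewrite kn !nth_k => /(_ isT).
rewrite !weight_cons !exprS.
have := sdom k.
have /andP[fk0 _] := factor_bound k j b.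
move: (weight (j :: js) a.1 k) (weight (j :: js) a.1 i) ai_gt0 => A Ai Ai_gt0.
move: (weight js s.1 k) (weight js s.1 i) si_gt0 => S Si Si_gt0.
move: (weight js bits k) (weight js bits i) wi_gt0 => U Ui Ui_gt0.
move: (factor k j b) (factor i j b) fk0 fi_gt0 => fk fi fk0 fi_gt0.
have := exprn_ge0 (size js) (_ : 0 <= H%:Z).
move=> /(_ isT); move: (H%:Z ^+ _) (H.+1%:Z ^+ _) => u v u0 le1 le2.
(* Transitivity through [t]: both inequalities are scaled so that the weight [Si] of the
   intermediate state under [i] can be cancelled. *)
rewrite -(ler_pM2r Si_gt0).
have e1 : 0 <= u * Ui by rewrite mulr_ge0 // ltW.
have e2 : 0 <= H.+1%:Z * fk * Ai by rewrite !mulr_ge0 // ltW.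
have := ler_wpM2l e1 le2; have := ler_wpM2l e2 le1; lia.
Qed.

End Semantics.

Arguments acts : simpl never.

(** * The algorithm on instances *)

Record inst (n : nat) := Inst {
  im : nat; iB : nat; iI : setting rat n im; ii : 'I_n; idelta : rat }.

Definition inv_floor (delta : rat) : nat := absz (denq delta %/ numq delta)%Z.

Definition instances (n : nat) : dom :=
  @Dom (inst n)
    (fun x => [/\ valid_setting (iI x), 0 < idelta x & bits_at_most (iB x) (iI x) (idelta x)])
    (fun x => im x + iB x + inv_floor (idelta x))%N.

Lemma rat_bits_denq (q : rat) b : (rat_bits q <= b)%N -> denq q <= (2 ^ b)%N%:Z.
Proof.
move=> qb; rewrite -[denq q]gez0_abs ?denq_ge0 // lez_nat.
apply: ltnW; apply: leq_trans (ltn_bit_length _) _.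
by rewrite leq_exp2l //; move: qb; rewrite /rat_bits; lia.
Qed.

Lemma dsize_enc_rat (q : rat) b : (rat_bits q <= b)%N -> (dsize (enc_rat q) <= b + 3)%N.
Proof. by rewrite /rat_bits /=; lia. Qed.

Lemma dsize_enc_fun (T : Type) m (f : T -> data) (v : 'I_m -> T) b :
  (forall j, (dsize (f (v j)) <= b)%N) -> (dsize (enc_fun f v) <= m * b.+1 + 1)%N.
Proof.
move=> H; rewrite /enc_fun enc_seq_map -[X in (_ <= X * _ + _)%N](size_enum_ord m).
by apply: dsize_enc_seq.
Qed.

Section Pc.
Variable n : nat.
Notation X := (instances n).

Lemma pbn_im : pbn (fun x : X => im x).
Proof. by apply: pbn_le (pbn_sz _) => x _ /=; lia. Qed.

Lemma pbn_iB : pbn (fun x : X => iB x).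
Proof. by apply: pbn_le (pbn_sz _) => x _ /=; lia. Qed.

Lemma input_bounded : pbn (fun x : X => dsize (enc_input (iI x) (ii x) (idelta x))).
Proof.
have b1 := pbn_add pbn_iB (pbn_cst _ 4).
have b2 := pbn_add (pbn_mul pbn_im b1) (pbn_cst _ 2).
have b3 := pbn_add (pbn_mul (pbn_cst _ n) b1) (pbn_cst _ 2).
have b4 := pbn_add (pbn_mul (pbn_cst _ n) b2) (pbn_cst _ 2).
have b5 := pbn_add pbn_iB (pbn_cst _ (n + 10)).
apply: pbn_le (pbn_add (pbn_add b2 b3) (pbn_add b4 b5)) => x [_ _ [cB rB qB dB]].
have Hc := dsize_enc_fun (fun k => dsize_enc_rat (cB k)).
have Hr := dsize_enc_fun (fun k => dsize_enc_rat (rB k)).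
have Hq := dsize_enc_fun (fun k => dsize_enc_fun (fun j => dsize_enc_rat (qB k j))).
have Hd := dsize_enc_rat dB.
have Hi : (bit_length (ii x) <= n)%N.
  by apply: bit_length_le; apply: ltn_trans (ltn_ord _) _; rewrite ltn_expl.
move: Hc Hr Hq Hd Hi; rewrite /enc_input /enc_setting /=; lia.
Qed.

Definition input : env X := Env input_bounded.

(** Large enough for [(6 * m + 3 * n) / H <= delta]: [6 * m] accounts for the ratio errors, and
    [3 * n] for rounding at most [n] payments. It also gives [2 * m <= H], as [growth_le]
    requires. *)
Definition grid (x : inst n) : nat :=
  ((6 * im x + 3 * n + 1) * (inv_floor (idelta x) + 1))%N.
Definition cost_list (x : inst n) := [seq num_den (cost (iI x) k) | k <- acts (ii x)].
Definition cols (x : inst n) : seq column :=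
  [seq item_col (iI x) (ii x) j | j <- enum 'I_(im x)].
Definition sts x := states n (grid x) (cols x).
Definition dens x := denoms n (cols x).
Definition opts x := options (grid x) (dens x) (sts x).
Definition good x := acceptable (grid x) (num_den (idelta x)) (dens x) (cost_list x).
Definition best x := select (good x) (cands n n (opts x)).

Lemma pc_setting : [/\ pc input (fun x => enc_fun enc_rat (cost (iI x))),
  pc input (fun x => enc_fun enc_rat (reward (iI x))),
  pc input (fun x => enc_fun (enc_fun enc_rat) (prob (iI x))),
  pc input (fun x => eN (ii x)) & pc input (fun x => eQ (num_den (idelta x)))].
Proof.
have p0 : pc input (fun x => Pair (enc_setting (iI x)) (Pair (Int (ii x)) (enc_rat (idelta x)))).
  exact: pc_env.
have ps : pc input (fun x => Pair (enc_fun enc_rat (cost (iI x)))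
  (Pair (enc_fun enc_rat (reward (iI x))) (enc_fun (enc_fun enc_rat) (prob (iI x))))).
  exact: pc_fst p0.
split.
- exact: pc_fst ps.
- exact: pc_fst (pc_snd ps).
- exact: pc_snd (pc_snd ps).
- exact: pc_fst (pc_snd p0).
- exact: pc_snd (pc_snd p0).
Qed.

Lemma pc_delta : pc input (fun x => eQ (num_den (idelta x))).
Proof. by case: pc_setting. Qed.

Lemma pc_im : pc input (fun x => eN (im x)).
Proof.
have [_ pr _ _ _] := pc_setting.
have : pc input (fun x => enc_seq eQ [seq num_den (reward (iI x) j) | j <- enum 'I_(im x)]).
  by apply: eq_pc pr => x _; rewrite /enc_fun !enc_seq_map.
move=> /(pc_size (0, 0)); apply: eq_pc => x _.
by rewrite size_map size_enum_ord.
Qed.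

Lemma pbn_grid : pbn (fun x : X => grid x).
Proof.
apply: pbn_le (pbn_mul (pbn_add (pbn_mul (pbn_cst _ 6) pbn_im) (pbn_cst _ (3 * n + 1)))
   (pbn_add (pbn_sz _) (pbn_cst _ 1))) => x _.
by rewrite /grid addnA leq_mul //=; lia.
Qed.

Lemma inv_floorE (delta : rat) : 0 < delta ->
  Posz (inv_floor delta) = (denq delta %/ numq delta)%Z.
Proof.
move=> d0; rewrite /inv_floor gez0_abs // divz_ge0 ?denq_ge0 //.
by rewrite numq_gt0.
Qed.

Lemma pc_grid : pc input (fun x => eN (grid x)).
Proof.
have pd := pc_delta.
apply: eq_pc (pc_mul (pc_add (pc_mul (pc_cst _ (Int 6)) pc_im) (pc_cst _ (Int (3 * n + 1)%N)))
   (pc_add (pc_div (pc_p2 pd) (pc_p1 pd)) (pc_cst _ (Int 1)))) => x [_ d0 _].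
by congr Int; rewrite /= -inv_floorE // /grid; lia.
Qed.

Lemma map_acts_nth (T : Type) (t0 : T) (i : 'I_n) (F : 'I_n -> T) :
  [seq F k | k <- acts i] = nth t0 [seq F k | k <- enum 'I_n] i :: [seq F k | k <- enum 'I_n].
Proof. by rewrite /acts map_cons (nth_map i) ?size_enum_ord // nth_ord_enum. Qed.

Lemma pc_cost_list : pc input (fun x => enc_seq eQ (cost_list x)).
Proof.
have [pco _ _ pi _] := pc_setting.
have pl : pc input (fun x => enc_seq eQ [seq num_den (cost (iI x) k) | k <- enum 'I_n]).
  by apply: eq_pc pco => x _; rewrite /enc_fun !enc_seq_map.
have iP (x : X) : ok x -> (ii x < size [seq num_den (cost (iI x) k) | k <- enum 'I_n])%N.
  by rewrite size_map size_enum_ord.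
have pn := pc_nth (0, 0) iP pl pi.
apply: eq_pc (pc_cons pn pl) => x _.
by rewrite /cost_list (map_acts_nth (0, 0)).
Qed.

(** The input lists the probabilities by action, the dynamic program consumes them by item; this is
    the transposition. *)
Lemma pc_cols : pc input (fun x => enc_seq (enc_seq eQ) (cols x)).
Proof.
have [_ _ pp pi _] := pc_setting.
pose row (x : X) k := [seq num_den (prob (iI x) k j) | j <- enum 'I_(im x)].
have pl : pc input (fun x => enc_seq (enc_seq eQ) [seq row x k | k <- enum 'I_n]).
  apply: eq_pc pp => x _; rewrite /enc_fun !enc_seq_map.
  by congr (enc_seq _ _); apply/funext => k; rewrite /row !enc_seq_map.
have iP (x : X) : ok x -> (ii x < size [seq row x k | k <- enum 'I_n])%N.
  by rewrite size_map size_enum_ord.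
have pn := pc_nth [::] iP pl pi.
have pr : pc input (fun x => enc_seq (enc_seq eQ) [seq row x k | k <- acts (ii x)]).
  by apply: eq_pc (pc_cons pn pl) => x _; rewrite (map_acts_nth [::]).
have pm : pc input (fun x => enc_seq eN (iota 0 (im x))) by apply: pc_iota pc_im pbn_im.
suff : pc input (fun x => enc_seq (enc_seq eQ)
    [seq [seq nth (0, 0) r j | r <- [seq row x k | k <- acts (ii x)]] | j <- iota 0 (im x)]).
  apply: eq_pc => x _; congr enc_seq; rewrite /cols -val_enum_ord -map_comp.
  apply: eq_map => j; rewrite /item_col /comp -map_comp; apply: eq_map => k.
  rewrite /comp /row (nth_map j) ?size_enum_ord; last exact: ltn_ord.
  by congr (num_den (prob _ _ _)); apply: nth_ord_enum.
apply: (pc_map 0%N [::] pm) => e1 lift1 pj.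
apply: (pc_map [::] (0, 0) (lift1 _ pr)) => e2 lift2 prow.
apply: pc_nth prow (lift2 _ pj) => -[[x j] r] [[okx jP] rP].
have /mapP[k _ ->] : r \in [seq row x k | k <- acts (ii x)] := rP.
by move: (jP : j \in iota 0 (im x)); rewrite mem_iota size_map size_enum_ord.
Qed.

Lemma uniq_size_ord m (js : seq 'I_m) : uniq js -> (size js <= m)%N.
Proof. by move=> /card_uniqP <-; rewrite -[X in (_ <= X)%N]card_ord max_card. Qed.

Lemma denom_bound (x : X) js k : ok x -> uniq js ->
  denom (iI x) js k <= (2 ^ (im x * iB x))%N%:Z.
Proof.
move=> [_ _ [_ _ qB _]] js_uniq.
have sz_js := uniq_size_ord js_uniq.
apply: (@le_trans _ _ (2 ^ (size js * iB x))%N%:Z); last first.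
  by rewrite lez_nat leq_exp2l // leq_mul2r sz_js orbT.
elim: js {js_uniq sz_js} => [|j js IH]; first by rewrite /denom big_nil.
rewrite /denom big_cons /= mulSn expnD PoszM ler_pM ?denq_ge0 //.
  exact: ltW (denom_gt0 _ _ _).
exact: rat_bits_denq.
Qed.

(** Intermediate folds run over suffixes of the columns; distinctness of the items keeps these
    within [m] items and so within the bound of [denom_bound]. *)
Lemma cols_suffix (x : X) l1 l2 : cols x = l1 ++ l2 ->
  exists2 js, uniq js & l2 = [seq item_col (iI x) (ii x) j | j <- js].
Proof.
move=> E; exists (drop (size l1) (enum 'I_(im x))).
  exact: drop_uniq (enum_uniq _).
by rewrite map_drop -/(cols x) E drop_size_cat.
Qed.

Lemma bit_length_int (a : int) L : 0 <= a <= (2 ^ L)%N%:Z ->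
  (dsize (eZ a) <= L.+2)%N.
Proof.
move=> aL; rewrite /eZ /= ltnS; apply: bit_length_le; rewrite expnS.
have : (0 < 2 ^ L)%N by rewrite expn_gt0.
by lia.
Qed.

Lemma prob01_ok (x : X) : ok x -> forall k j, 0 <= prob (iI x) k j <= 1.
Proof. by move=> [[]]. Qed.

Lemma grid_gt0 (x : inst n) : (0 < grid x)%N.
Proof. by rewrite /grid muln_gt0; lia. Qed.

(** Weights may be as large as [2 ^ L] with [L = m * B], but both their bit size and the number of
    kept states are polynomial in [L]. *)
Lemma pc_sts : pc input (fun x => enc_seq eState (sts x)).
Proof.
apply: (pc_states pc_grid pc_cols).
set Q := fun _ _ => _.
have bm : pbn (fun y : ext Q => im y.1) := pbn_ext Q pbn_im.
have bL : pbn (fun y : ext Q => (im y.1 * iB y.1)%N) := pbn_ext Q (pbn_mul pbn_im pbn_iB).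
have bH : pbn (fun y : ext Q => grid y.1) := pbn_ext Q pbn_grid.
have bS := pbn_exp n.+1 (pbn_add (pbn_mul (pbn_mul (pbn_cst _ 2) bL) bH) (pbn_cst _ 2)).
have bE := pbn_add (pbn_add (pbn_mul bm (pbn_cst _ 3))
   (pbn_mul (pbn_cst _ n.+1) (pbn_add bL (pbn_cst _ 3)))) (pbn_cst _ 4).
apply: pbn_le (pbn_add (pbn_mul bS bE) (pbn_cst _ 1)) => -[x l2] [/= okx [l1 /cols_suffix[js ujs ->]]].
have p01 := prob01_ok okx.
have dB k : denom (iI x) js k <= (2 ^ (im x * iB x))%N%:Z by apply: denom_bound.
have szS := states_size (ii x) p01 (grid_gt0 x) dB.
apply: leq_trans (dsize_enc_seq (b := im x * 3 + n.+1 * (im x * iB x + 3) + 3) _) _.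
  move=> s /states_wf[sz Es _].
  have H1 : (dsize (enc_seq eB s.1) <= im x * 3 + 1)%N.
    apply: leq_trans (dsize_enc_seq (b := 2) _) _; first by case.
    by rewrite leq_add2r leq_mul2r sz uniq_size_ord.
  have H2 : (dsize (enc_seq eZ s.2) <= n.+1 * (im x * iB x + 3) + 1)%N.
    apply: leq_trans (dsize_enc_seq (b := (im x * iB x).+2) _) _.
      move=> w; rewrite Es => /mapP[k _ ->]; apply: bit_length_int.
      have /andP[-> w1] := weight_bound p01 js s.1 k.
      exact: le_trans w1 (dB k).
    by rewrite Es size_map size_acts addn3.
  rewrite /eState /epair /=. apply: leq_ltn_trans (leq_add H1 H2) _; lia.
rewrite leq_add2r leq_mul ?addn2 //.
by lia.
Qed.

Lemma pc_dens : pc input (fun x => enc_seq eZ (dens x)).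
Proof.
apply: (pc_denoms pc_cols).
set Q := fun _ _ => _.
have bL : pbn (fun y : ext Q => (im y.1 * iB y.1)%N) := pbn_ext Q (pbn_mul pbn_im pbn_iB).
apply: pbn_le (pbn_add (pbn_mul (pbn_cst _ n.+1) (pbn_add bL (pbn_cst _ 3))) (pbn_cst _ 1)).
move=> -[x l2] [/= okx [l1 /cols_suffix[js ujs ->]]].
rewrite denoms_acts.
apply: leq_trans (dsize_enc_seq (b := (im x * iB x).+2) _) _.
  move=> w /mapP[k _ ->]; apply: bit_length_int.
  by rewrite ltW ?denom_gt0 // denom_bound.
by rewrite size_map size_acts addn3.
Qed.

Lemma pc_best : pc input (fun x => eBest (best x)).
Proof.
have po : pc input (fun x : X => enc_seq eOption (opts x)).
  exact: pc_options pc_grid pbn_grid pc_dens pc_sts.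
have pcs : pc input (fun x : X => enc_seq eCand (cands n n (opts x))) by apply: pc_cands.
apply: (pc_select (P := fun x : X => good x) pcs) => e' lift pcand.
exact: (pc_acceptable (lift _ pc_grid) (lift _ pc_delta) (lift _ pc_dens)
  (lift _ pc_cost_list) pcand).
Qed.

Lemma pc_answer : pc input (fun x =>
  if best x is Some c then Pair (Int 1) (enc_seq eEntry c.1) else Int 0).
Proof.
have pb := pc_best.
apply: eq_pc (pc_if (pc_ispair pb) (pc_pair (pc_cst _ (Int 1)) (pc_dfst (pc_dsnd pb)))
  (pc_cst _ (Int 0))) => x _.
by case: (best x).
Qed.

End Pc.

(** * Sparse solutions *)

Section Caratheodory.
Variables (R : realFieldType) (T : finType) (n : nat) (a : 'I_n -> T -> R).

Lemma linear_dependence (S : {set T}) : (n < #|S|)%N ->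
  exists l : T -> R, [/\ forall t, t \notin S -> l t = 0,
    forall k, \sum_t a k t * l t = 0 & exists t, l t != 0].
Proof.
move=> nS; pose A : 'M[R]_(#|S|, n) := \matrix_(s, k) a k (enum_val s).
have : kermx A != 0.
  rewrite kermx_eq0 /row_free neq_ltn; apply/orP; left.
  exact: leq_ltn_trans (rank_leq_col A) nS.
move=> /rowV0Pn[v /sub_kermxP vA v_neq0].
pose l t : R := \sum_(s < #|S|) v 0 s * (enum_val s == t)%:R.
have l_val s : l (enum_val s) = v 0 s.
  rewrite /l (bigD1 s) //= eqxx mulr1 big1 ?addr0 // => s' ns.
  by rewrite (inj_eq enum_val_inj) (negbTE ns) mulr0.
exists l; split.
- move=> t tS; apply: big1 => s _; case: eqP => [E|_]; last by rewrite mulr0.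
  by rewrite -E enum_valP in tS.
- move=> k; have /rowP/(_ k) := vA; rewrite !mxE; apply: etrans.
  under eq_bigr do rewrite /l mulr_sumr.
  rewrite exchange_big; apply: eq_bigr => s _; rewrite !mxE (bigD1 (enum_val s)) //=.
  rewrite eqxx mulr1 big1 ?addr0 1?mulrC // => t.
  by rewrite eq_sym => /negbTE ->; rewrite !mulr0.
- apply/existsP; apply: contra_neqT v_neq0 => /existsPn l0.
  apply/rowP => s; rewrite mxE -l_val.
  by have := l0 (enum_val s); rewrite negbK => /eqP.
Qed.

(** The conic form: all [n] sums are preserved exactly. For a contract these are the expected
    payments of the [n] actions, so sparsifying changes no utility. *)
Lemma caratheodory (p : T -> R) : (forall t, 0 <= p t) ->
  exists p', [/\ forall t, 0 <= p' t,
    forall k, \sum_t a k t * p' t = \sum_t a k t * p t &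
    (#|[set t | p' t != 0%R]| <= n)%N].
Proof.
have [N] := ubnP #|[set t | p t != 0%R]|; elim: N p => // N IH p; rewrite ltnS => pN p_ge0.
have [small|big] := leqP #|[set t | p t != 0%R]| n; first by exists p.
have [l0 [l0S l0a [t0' l0t]]] := linear_dependence big.
have [l [lS la [t0 lt0]]] : exists l : T -> R, [/\ forall t, p t = 0 -> l t = 0,
    forall k, \sum_t a k t * l t = 0 & exists t, 0 < l t].
  have S0 t : p t = 0 -> l0 t = 0 by move=> pt; apply: l0S; rewrite inE pt eqxx.
  have [neg|pos] := ltP (l0 t0') 0.
    exists (fun t => - l0 t); split.
    - by move=> t /S0 ->; rewrite oppr0.
    - by move=> k; under eq_bigr do rewrite mulrN; rewrite sumrN l0a oppr0.
    - by exists t0'; rewrite oppr_gt0.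
  by exists l0; split=> //; exists t0'; rewrite lt_def l0t.
(* Moving [p] along [- l] until the first coordinate vanishes: the smallest ratio keeps the others
   nonnegative and removes [t1] from the support. *)
case: (arg_minP (P := fun t => 0 < l t) (fun t => p t / l t) lt0) => t1 lt1 t1min.
pose th := p t1 / l t1; pose p' t := p t - th * l t.
have th_ge0 : 0 <= th by rewrite divr_ge0 // ltW.
have p'_ge0 t : 0 <= p' t.
  rewrite subr_ge0; have [lt_le|lt_gt] := leP (l t) 0.
    by apply: le_trans (p_ge0 t); rewrite mulr_ge0_le0.
  by have := t1min t lt_gt; rewrite -/th ler_pdivlMr.
have sum_p' k : \sum_t a k t * p' t = \sum_t a k t * p t.
  under eq_bigr do rewrite mulrBr mulrCA.
  by rewrite sumrB -mulr_sumr la mulr0 subr0.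
have [|q [q_ge0 qa qn]] := IH p' _ p'_ge0; last first.
  by exists q; split=> // k; rewrite qa sum_p'.
apply: leq_trans pN; apply: proper_card; apply/properP; split.
  apply/fintype.subsetP => t; rewrite !inE; apply: contraNneq => pt.
  by rewrite /p' pt lS // mulr0 subr0.
exists t1; rewrite !inE.
  by apply: contraTneq lt1 => /lS ->; rewrite ltxx.
by rewrite /p' /th divfK ?subrr ?eqxx // gt_eqF.
Qed.

End Caratheodory.

(** * Payments of a sparse contract *)

Definition bits_of m (S : {set 'I_m}) : seq bool := [seq j \in S | j <- enum 'I_m].

Definition set_of_bits m (bs : seq bool) : {set 'I_m} := [set j : 'I_m | nth false bs j].

Lemma size_bits_of m (S : {set 'I_m}) : size (bits_of S) = m.
Proof. by rewrite size_map size_enum_ord. Qed.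

Lemma set_of_bitsK m bs : size bs = m -> bits_of (set_of_bits m bs) = bs.
Proof.
move=> sz; apply: (eq_from_nth (x0 := false)); rewrite size_bits_of // => j jm.
by rewrite (nth_map (Ordinal jm)) ?size_enum_ord // inE nth_enum_ord.
Qed.

Section Payments.
Variables (R : realFieldType) (n m : nat) (I : setting rat n m).
Let J : setting R n m := map_setting ratr I.
Let js := enum 'I_m.

Lemma ratrE (q : rat) : ratr q = (numq q)%:~R / (denq q)%:~R :> R.
Proof. by []. Qed.

Lemma outcome_probE k S : outcome_prob J k S =
  (weight I js (bits_of S) k)%:~R / (denom I js k)%:~R.
Proof.
rewrite /outcome_prob /weight /denom /bits_of -/js.
rewrite -[X in zip X _]map_id zip_map big_map !rmorph_prod /= -prodf_div /=.
rewrite big_enum /= [RHS](bigID [in S]) /=; congr (_ * _).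
  by apply: eq_bigr => j jS; rewrite /factor jS.
apply: eq_big => [j|j]; rewrite inE // => /negbTE jS.
rewrite /factor jS rmorphB /= mulrBl divff ?intr_eq0 ?denq_neq0 //.
Qed.

(** An outcome may be listed several times, as when two options use the same representative; its
    entries then add up on both sides. *)
Lemma exp_payment_sparse (s : sparse_contract m) k :
  exp_payment J (contract_of R s) k = \sum_(e <- s) outcome_prob J k e.1 * ratr e.2.
Proof.
rewrite /exp_payment; under eq_bigr do rewrite ffunE rmorph_sum mulr_sumr big_mkcond /=.
rewrite exchange_big /=; apply: eq_bigr => e _.
rewrite (bigD1 e.1) //= eqxx big1 ?addr0 // => S.
by rewrite eq_sym => /negbTE ->.
Qed.

End Payments.

(** * Correctness *)

Lemma ic_testP (R : realFieldType) H (d : int * int) P D (c : int * int)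
    (q : int * int * (int * int)) :
  (0 < H)%N -> 0 < d.2 -> 0 < D -> 0 < c.2 -> 0 < q.1.2 -> 0 < q.2.2 ->
  ic_test H d P D c q =
  (q.1.1%:~R / (q.1.2%:~R * (H%:R * H%:R)) - q.2.1%:~R / q.2.2%:~R - d.1%:~R / d.2%:~R
   <= P%:~R / (D%:~R * (H%:R * H%:R)) - c.1%:~R / c.2%:~R :> R).
Proof.
case: d c q => [d1 d2] [c1 c2] [[P' D'] [c1' c2']] /= H0 d0 D0 c0 D'0 c'0.
rewrite /ic_test /= -(ler_int R) !(rmorphD, rmorphM) /= -!pmulrn.
set h : R := H%:R; have h0 : 0 < h by rewrite ltr0n.
move: d0 D0 c0 D'0 c'0; rewrite -!(ltr0z R).
move: (d1%:~R : R) (d2%:~R : R) (c1%:~R : R) (c2%:~R : R) (P'%:~R : R) (D'%:~R : R)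
  (c1'%:~R : R) (c2'%:~R : R) (P%:~R : R) (D%:~R : R).
move=> {d1 d2 c1 c2 P' D' c1' c2' P D} d1 d2 c1 c2 P' D' c1' c2' P D d0 D0 c0 D'0 c'0.
(* The product of all denominators; multiplying by it turns the rational inequality into the integer
   one. *)
have X0 : 0 < h * h * D * D' * c2 * c2' * d2 by rewrite !mulr_gt0.
rewrite -[RHS](ler_pM2r X0) -[LHS]subr_ge0 -[RHS]subr_ge0; congr (0 <= _).
by field; rewrite !gt_eqF.
Qed.

Lemma all_acts n (i : 'I_n) (P : pred 'I_n) : all P (acts i) = [forall k, P k].
Proof.
apply/allP/forallP => [aP k|aP k _]; last exact: aP.
by apply: aP; rewrite /acts inE mem_enum orbT.
Qed.

Section Candidates.
Variables (R : realType) (n : nat) (x : instances n).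
Let m := im x.
Let I : setting rat n m := iI x.
Let J : setting R n m := map_setting ratr I.
Let i := ii x.
Let H := grid x.
Let js := enum 'I_m.
Let w (bs : seq bool) (k : 'I_n) := weight I js bs k.
Let D (k : 'I_n) := denom I js k.

Definition grid_payment (z : int * int) : Prop :=
  exists2 b : int, 0 <= b & z = (b * H%:Z + 1, H%:Z * H%:Z).

Definition entry_payment (k : 'I_n) (e : seq bool * (int * int)) : R :=
  (w e.1 k)%:~R / (D k)%:~R * (e.2.1%:~R / e.2.2%:~R).

Definition total_payment (c : cand) (k : 'I_n) : R := \sum_(e <- c.1) entry_payment k e.

Let H_gt0 : (0 < H)%N := grid_gt0 x.
Let D_gt0 k : 0 < D k. Proof. exact: denom_gt0. Qed.

Lemma dens_acts : dens x = [seq D k | k <- acts i].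
Proof. exact: denoms_acts. Qed.

Lemma sts_wf s : s \in sts x ->
  [/\ size s.1 = m, s.2 = [seq w s.1 k | k <- acts i] & 0 < w s.1 i].
Proof. by move=> /states_wf[-> -> ?]; rewrite size_enum_ord. Qed.

Lemma opts_wf o : o \in opts x ->
  [/\ size o.1.1 = m, grid_payment o.1.2 &
      o.2 = [seq w o.1.1 k * o.1.2.1 | k <- acts i]].
Proof.
move=> /flattenP[_ /mapP[s /sts_wf[sz Es w_gt0] ->] /mapP[g _ ->]] /=; split=> //.
  exists (g%:Z * head 0 (dens x) %/ head 0 s.2)%Z => //.
  rewrite dens_acts Es divz_ge0 //= mulr_ge0 //.
  by have := D_gt0 i; lia.
by move: (payment_num _ _ _ _) => z; rewrite Es -map_comp.
Qed.

Lemma cands_wf t c : c \in cands n t (opts x) ->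
  (forall e, e \in c.1 -> size e.1 = m /\ grid_payment e.2) /\
  c.2 = [seq \sum_(e <- c.1) w e.1 k * e.2.1 | k <- acts i].
Proof.
elim: t c => [|t IH] c.
  rewrite inE => /eqP ->; split=> //; rewrite -[LHS]/(nseq n.+1 0) -(map_acts_const i).
  by apply: eq_map => k; rewrite big_nil.
move=> /flattenP[_ /mapP[c' /IH[c'wf Ec'] ->]]; rewrite inE => /orP[/eqP -> //|].
move=> /mapP[o /opts_wf[sz pay Eo] ->] /=; split.
  by move=> e; rewrite inE => /orP[/eqP -> //|/c'wf].
rewrite Ec' Eo zip_map -map_comp; apply: eq_map => k.
by rewrite /comp big_cons addrC.
Qed.

Lemma total_paymentE t c k : c \in cands n t (opts x) ->
  total_payment c k = (\sum_(e <- c.1) w e.1 k * e.2.1)%:~R / ((D k)%:~R * (H%:R * H%:R)).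
Proof.
move=> /cands_wf[cwf _]; rewrite rmorph_sum mulr_suml /total_payment.
apply: eq_big_seq => e /cwf[_ [b _ Eb]].
rewrite /entry_payment Eb /= !rmorphM /= -!pmulrn mulf_div.
by rewrite -!mulrA.
Qed.

Lemma goodP c t : c \in cands n t (opts x) ->
  reflect (total_payment c i <= 2 /\
     forall k, total_payment c k - cost J k - ratr (idelta x) <=
               total_payment c i - cost J i)
    (good x c).
Proof.
move=> cin; have [_ Ec] := cands_wf cin.
have DHH_gt0 k : 0 < (D k)%:~R * (H%:R * H%:R) :> R.
  by rewrite !mulr_gt0 ?ltr0z ?ltr0n.
rewrite /good /acceptable -all_predC -/H.
rewrite /cost_list -/I -/i Ec dens_acts !zip_map all_map all_acts.
rewrite -[head 0 _]/(\sum_(e <- c.1) w e.1 i * e.2.1) -[head 0 _]/(D i).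
rewrite -[head (0, 0) _]/(num_den (cost I i)).
have -> : (\sum_(e <- c.1) w e.1 i * e.2.1 <= 2%:Z * D i * (H%:Z * H%:Z)) =
    (total_payment c i <= 2).
  rewrite (total_paymentE _ cin) ler_pdivrMr // -(ler_int R) !rmorphM /= -!pmulrn.
  by rewrite -[2 * _ * _]mulrA.
apply: (iffP andP) => -[c2 ic]; split=> //.
  move=> k; have /forallP/(_ k) := ic.
  rewrite /= negbK (@ic_testP R) ?denq_gt0 //= ?denq_gt0 //.
  by rewrite -!(total_paymentE _ cin).
apply/forallP => k; rewrite /= negbK (@ic_testP R) ?denq_gt0 //= ?denq_gt0 //.
by rewrite -!(total_paymentE _ cin); apply: ic.
Qed.

Lemma extend_keep os cs c : c \in cs -> c \in extend os cs.
Proof.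
move=> ccs; apply/flattenP; eexists; first exact: map_f ccs.
exact: mem_head.
Qed.

Lemma extend_add os cs c o : c \in cs -> o \in os ->
  (o.1 :: c.1, [seq p.1 + p.2 | p <- zip c.2 o.2]) \in extend os cs.
Proof.
move=> ccs oos; apply/flattenP; eexists; first exact: map_f ccs.
rewrite inE; apply/orP; right.
exact: (map_f (fun o => (o.1 :: c.1, [seq p.1 + p.2 | p <- zip c.2 o.2]))).
Qed.

End Candidates.

(** * Estimates for the ratio error and the rounding error *)

Lemma growth_le (R : realFieldType) (h : R) k : 0 < h -> 2 * k%:R <= h ->
  ((h + 1) / h) ^+ k <= 1 + 2 * k%:R / h.
Proof.
move=> h0; have hn0 : h != 0 by rewrite gt_eqF.
elim: k => [|k IH]; first by rewrite expr0 mulr0 mul0r addr0.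
rewrite -natr1 => kh; have kh' : 2 * k%:R <= h by lra.
have := IH kh'; set u := h^-1; have u0 : 0 < u by rewrite invr_gt0.
have -> : (h + 1) / h = 1 + u by rewrite mulrDl mul1r divff.
rewrite exprS => IHu.
(* This absorbs the quadratic term in [(1 + u) * (1 + 2 * k * u) <= 1 + (2 * k + 2) * u]. *)
have e1 : (2 * k%:R + 2) * u <= 1 by rewrite ler_pdivrMr // mul1r; lra.
apply: le_trans (ler_wpM2l (_ : 0 <= 1 + u) IHu) _; first by lra.
have := ler_wpM2r (ltW u0) e1; have k0 : 0 <= k%:R :> R by [].
have : 0 <= u * u by nra.
nra.
Qed.

(** [u * u] is set aside for the extra [1/H^2] in every payment, so the upper bound [X] is
    respected. The loss [3 * u] consists of this reserve, of rounding [X] down to the grid, and of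
    rounding the payment itself down to [F]. *)
Lemma rounding_error (R : realFieldType) (q X u g F : R) :
  0 < u <= 1 -> 0 <= q <= 1 -> g * u <= X - u * u -> X - u * u < (g + 1) * u ->
  q * F <= g -> g <= q * (F + 1) ->
  X - 3 * u <= q * (F * u + u * u) <= X.
Proof.
move=> /andP[u0 u1] /andP[q0 q1] gX Xg qF gq.
have e1 := ler_wpM2r (ltW u0) qF; have e2 := ler_wpM2r (ltW u0) gq.
have uu : 0 <= u * u by nra.
have e3 : q * (u * u) <= u * u by rewrite ler_piMl.
have e4 : 0 <= q * (u * u) by rewrite mulr_ge0.
have e5 : u * u <= u by rewrite ler_piMl // ltW.
have e6 : q * u <= u by rewrite ler_piMl // ltW.
by apply/andP; split; nra.
Qed.

Section Existence.
Variables (R : realType) (n : nat) (x : instances n).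
Hypothesis okx : ok x.
Let m := im x.
Let I : setting rat n m := iI x.
Let J : setting R n m := map_setting ratr I.
Let i := ii x.
Let H := grid x.
Let h : R := H%:R.
Let js := enum 'I_m.
Let w (bs : seq bool) (k : 'I_n) := weight I js bs k.
Let D (k : 'I_n) := denom I js k.
Let theta : R := ((h + 1) / h) ^+ m.
Let pay := @entry_payment R n x.

Let H_gt0 : (0 < H)%N := grid_gt0 x.
Let p01 := prob01_ok okx.
Let D_gt0 k : 0 < D k. Proof. exact: denom_gt0. Qed.
Let h_gt0 : 0 < h. Proof. by rewrite ltr0n. Qed.
Let DR_gt0 k : 0 < (D k)%:~R :> R. Proof. by rewrite ltr0z. Qed.

Lemma weight_ratio bs k : 0 <= ((w bs k)%:~R / (D k)%:~R : R) <= 1.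
Proof.
have /andP[w0 w1] := weight_bound p01 js bs k.
by rewrite divr_ge0 ?ler0z ?(ltW (D_gt0 k)) //= ler_pdivrMr // mul1r ler_int.
Qed.

(** [theta] collects one factor [1 + 1/H] for each of the [m] items. The ratios stay
    cross-multiplied, since the common denominators of each action cancel. *)
Lemma representative S : 0 < outcome_prob J i S ->
  exists2 s, s \in sts x & forall k,
    (w s.1 k)%:~R / (D k)%:~R * outcome_prob J i S <=
    theta * outcome_prob J k S * ((w s.1 i)%:~R / (D i)%:~R).
Proof.
rewrite outcome_probE => q_gt0.
have w_gt0 : 0 < weight I js (bits_of S) i.
  by move: q_gt0; rewrite pmulr_lgt0 ?invr_gt0 // ltr0z.
have [|s sP sdom] := states_dominate p01 H_gt0 _ w_gt0.
  by rewrite size_bits_of size_enum_ord.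
exists s => // k; rewrite outcome_probE.
have := sdom k; rewrite size_enum_ord -(ler_int R) !rmorphM !rmorphXn /= -!pmulrn.
rewrite -/h -natr1 -/h -/m.
rewrite -/(w s.1 k) -/(w s.1 i) -/js -/(D k) -/(D i) /theta expr_div_n.
have := DR_gt0 k; have := DR_gt0 i; have : 0 < h ^+ m by rewrite exprn_gt0.
move: (h ^+ m) ((h + 1) ^+ m) ((D k)%:~R : R) ((D i)%:~R : R) => a b dk di a0 di0 dk0.
move: ((w s.1 k)%:~R : R) ((w s.1 i)%:~R : R) => sk si.
move: ((weight I js (bits_of S) k)%:~R : R) ((weight I js (bits_of S) i)%:~R : R) => Wk Wi.
move=> le1.
have X0 : 0 < a * dk * di by rewrite !mulr_gt0.
rewrite -(ler_pM2r X0) -subr_ge0 -[X in 0 <= X](_ : b * Wk * si - a * sk * Wi = _).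
  by rewrite subr_ge0.
by field; rewrite !gt_eqF.
Qed.

Lemma round_outcome S (y : R) : 0 <= y -> outcome_prob J i S * y <= 2 ->
  outcome_prob J i S * y - 3 / h <= 0 \/
  exists2 o, o \in opts x &
    outcome_prob J i S * y - 3 / h <= pay i o.1 <= outcome_prob J i S * y /\
    forall k, pay k o.1 <= theta * (outcome_prob J k S * y).
Proof.
move=> y0; set X := outcome_prob J i S * y => X2.
pose u := h^-1; have u0 : 0 < u by rewrite invr_gt0.
have u1 : u <= 1 by rewrite invf_le1 // ler1n.
(* A contribution below [1/H^2] cannot be rounded down to an admissible payment; it is left out, at
   a loss below [3/H]. *)
have [Xu|uX] := ltP X (u * u).
  by left; rewrite -/u; nra.
right; have q_ge0 : 0 <= outcome_prob J i S.
  by rewrite outcome_probE; case/andP: (weight_ratio (bits_of S) i).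
have q_gt0 : 0 < outcome_prob J i S.
  rewrite lt_def q_ge0 andbT; apply: contraTneq uX => q0.
  by rewrite /X q0 mul0r -ltNge mulr_gt0.
have [s sP sdom] := representative q_gt0.
have [sz Es w_gt0] := sts_wf sP.
pose g := Num.truncn ((X - u * u) * h).
have /andP[gl gr] : g%:R <= (X - u * u) * h < g.+1%:R.
  by apply: truncn_itv; rewrite mulr_ge0 ?subr_ge0 // ltW.
(* The cap [X <= 2] is what places [g] in the range enumerated by [options]. *)
have g2 : (g < (2 * H).+1)%N.
  rewrite ltnS -(ler_nat R); apply: le_trans gl _.
  by rewrite natrM -/h ler_pM2r //; nra.
pose F := (g%:Z * D i %/ w s.1 i)%Z.
pose num := payment_num H (dens x) s.2 g.
have numE : num = F * H%:Z + 1 by rewrite /num /payment_num dens_acts Es.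
exists ((s.1, (num, H%:Z * H%:Z)), [seq v * num | v <- s.2]).
  apply/flattenP; eexists; first exact: map_f sP.
  apply/mapP; exists g => //.
  by rewrite mem_iota.
have payE k : pay k (s.1, (num, H%:Z * H%:Z)) =
    (w s.1 k)%:~R / (D k)%:~R * (F%:~R * u + u * u).
  have HzE : (H%:Z)%:~R = h by rewrite -pmulrn.
  rewrite /pay /entry_payment /= numE; move: (H%:Z) HzE => Hz HzE.
  rewrite !(rmorphD, rmorphM) /= HzE -/js.
  by rewrite -/(w s.1 k) -/(D k) /u; congr (_ * _); field; rewrite gt_eqF.
have wR_gt0 : 0 < (w s.1 i)%:~R :> R by rewrite ltr0z.
have [Fl Fr] : F * w s.1 i <= g%:Z * D i /\ g%:Z * D i <= (F + 1) * w s.1 i.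
  by split; [apply: lez_floor; rewrite gt_eqF|apply/ltW/ltz_ceil].
have bnd : X - 3 / h <= pay i (s.1, (num, H%:Z * H%:Z)) <= X.
  rewrite payE; apply: (@rounding_error _ _ _ _ g%:R); rewrite ?u0 ?u1 ?weight_ratio //.
  - by rewrite ler_pdivrMr.
  - by rewrite natr1 ltr_pdivlMr.
  - rewrite mulrAC ler_pdivrMr //; move: Fl.
    by rewrite -(ler_int R) !rmorphM /= -!pmulrn mulrC.
  - rewrite mulrAC ler_pdivlMr //; move: Fr.
    by rewrite -(ler_int R) !(rmorphM, rmorphD) /= -!pmulrn [_ * (_ + _)]mulrC.
split=> // k; move: bnd => /andP[_]; rewrite !payE /=.
set z := F%:~R * u + u * u => bnd.
have z0 : 0 <= z.
  rewrite addr_ge0 ?mulr_ge0 ?(ltW u0) // ler0z divz_ge0 //.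
  by rewrite mulr_ge0 ?(ltW (D_gt0 i)).
have qi_gt0 : 0 < (w s.1 i)%:~R / (D i)%:~R :> R by rewrite divr_gt0.
have := sdom k; have := bnd; rewrite /X.
have /andP[] := weight_ratio s.1 k.
have : 0 <= outcome_prob J k S.
  by rewrite outcome_probE; case/andP: (weight_ratio (bits_of S) k).
move: ((w s.1 k)%:~R / (D k)%:~R) ((w s.1 i)%:~R / (D i)%:~R) qi_gt0 => qk qi qi0.
have th0 : 0 <= theta by rewrite exprn_ge0 // divr_ge0 ?ltW // addr_gt0.
move: (outcome_prob J k S) (outcome_prob J i S) q_gt0 theta th0 => Qk Qi Qi0 th th0.
move=> Qk0 qk0 qk1 le1 le2.
(* Under [i] the rounded payment is worth at most the original one ([le1]), and relative to [i]
   action [k] gains at most the factor [th] ([le2]); scaling by [qi * Qi] chains the two. *)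
rewrite -(ler_pM2r qi0) -(ler_pM2r Qi0).
have := ler_wpM2l (mulr_ge0 z0 (ltW qi0)) le2.
have e : 0 <= th * Qk * qi by rewrite !mulr_ge0 // ltW.
have := ler_wpM2l e le1; nra.
Qed.
End Existence.

(** * Rounding a whole contract, and optimality of the selected candidate *)

Section Optimality.
Variables (R : realType) (n : nat) (x : instances n).
Hypothesis okx : ok x.
Let m := im x.
Let J : setting R n m := map_setting ratr (iI x).
Let i := ii x.
Let h : R := (grid x)%:R.
Let theta : R := ((h + 1) / h) ^+ m.
Let total := @total_payment R n x.

Let h_gt0 : 0 < h. Proof. by rewrite ltr0n grid_gt0. Qed.

Lemma outcome_prob_ge0 k S : 0 <= outcome_prob J k S.
Proof.
rewrite outcome_probE; case/andP: (weight_ratio R okx (bits_of S) k) => + _.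
exact.
Qed.

Lemma cands_nil t : ([::], nseq n.+1 0) \in cands n t (opts x).
Proof. by elim: t => [|t IH]; [rewrite mem_head|apply: extend_keep]. Qed.

(** Each listed outcome uses one round of [extend], either adding its rounded option or keeping the
    candidate if the outcome is left out; both lose at most [3/h] under [i]. *)
Lemma cands_cover t (l : seq ({set 'I_m} * R)) : (size l <= t)%N ->
  (forall e, e \in l -> 0 <= e.2 /\ outcome_prob J i e.1 * e.2 <= 2) ->
  exists2 c, c \in cands n t (opts x) &
    \sum_(e <- l) outcome_prob J i e.1 * e.2 - 3 * (size l)%:R / h <= total c i
      <= \sum_(e <- l) outcome_prob J i e.1 * e.2 /\
    forall k, total c k <= theta * \sum_(e <- l) outcome_prob J k e.1 * e.2.
Proof.
elim: l t => [|[S y] l IH] t.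
  move=> _ _; exists ([::], nseq n.+1 0); first exact: cands_nil.
  rewrite !big_nil /total /total_payment /= big_nil !mulr0 mul0r subrr lexx; split=> // k.
  by rewrite !big_nil mulr0.
case: t => // t; rewrite ltnS => lt l_ok.
have [|c cin [cb ck]] := IH t lt.
  by move=> e el; apply: l_ok; rewrite inE el orbT.
have [/= y0 Sy2] := l_ok (S, y) (mem_head _ _).
have th0 : 0 <= theta by rewrite exprn_ge0 // divr_ge0 ?ltW // addr_gt0.
have size_eq : 3 * (size l).+1%:R / h = 3 * (size l)%:R / h + 3 / h.
  by rewrite -[(size l).+1%:R]natr1 mulrDr mulr1 mulrDl.
have [small|[o oin [ob okk]]] := round_outcome okx y0 Sy2.
  exists c; first exact: extend_keep.
  rewrite big_cons /=; split=> [|k].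
    rewrite size_eq; move: cb small; rewrite -/h -/J => /andP[cl cr] small.
    have := mulr_ge0 (outcome_prob_ge0 i S) y0.
    by move=> Q0; apply/andP; split; lra.
  apply: le_trans (ck k) _; rewrite big_cons /= ler_wpM2l // lerDr.
  by rewrite mulr_ge0 ?outcome_prob_ge0.
exists (o.1 :: c.1, [seq p.1 + p.2 | p <- zip c.2 o.2]); first exact: extend_add.
rewrite /total /total_payment; split=> [|k]; rewrite !big_cons /=.
  rewrite size_eq; move: cb ob; rewrite -/h -/J /total /total_payment.
  by move=> /andP[? ?] /andP[? ?]; apply/andP; split; lra.
rewrite mulrDr lerD //; exact: ck.
Qed.

(** Normalization enters here: a cost is at most the expected reward, which is at most 1. *)
Lemma cost_le1 k : 0 <= cost J k <= 1.
Proof.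
have [[_ _ c0 cm wf nm _ _] _ _] := okx.
rewrite /= ler0q -[1]/(1%:R) -(ratr_nat R 1) ler_rat; apply/andP; split.
  have n0 : (0 < n)%N by apply: leq_ltn_trans (ltn_ord k).
  by rewrite -(c0 (Ordinal n0)) // cm.
by have := wf k; have := nm k; lra.
Qed.

Lemma grid_error : (6 * m%:R + 3 * n%:R) / h <= ratr (idelta x) :> R.
Proof.
have [_ d0 _] := okx; set d : R := ratr _.
have dgt0 : 0 < d by rewrite ltr0q.
pose f := inv_floor (idelta x).
have fd : 1 <= d * (f%:R + 1).
  have num0 : 0 < numq (idelta x) by rewrite numq_gt0.
  have := ltz_ceil (denq (idelta x)) num0.
  rewrite -inv_floorE // -/f -(ltr_int R) !(rmorphM, rmorphD) /= -pmulrn => /ltW.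
  rewrite /d ratrE mulrAC ler_pdivlMr ?ltr0z ?denq_gt0 // mul1r.
  by rewrite mulrC.
rewrite ler_pdivrMr //.
have -> : h = (6 * m%:R + 3 * n%:R + 1) * (f%:R + 1).
  by rewrite /h /grid natrM !natrD -/m -/f; ring.
set a : R := 6 * m%:R + 3 * n%:R.
have a0 : 0 <= a by rewrite addr_ge0 ?mulr_ge0.
rewrite mulrCA; apply: le_trans (_ : (a + 1) * 1 <= _); first lra.
by rewrite ler_wpM2l //; lra.
Qed.

Lemma exists_good p : is_contract p -> dIC J 0 p i -> exp_payment J p i <= 2 ->
  exists c, [/\ c \in cands n n (opts x), good x c & total c i <= exp_payment J p i].
Proof.
move=> p0 ic p2.
have [p' [p'0 p'E supp]] := caratheodory (fun k S => outcome_prob J k S) p0.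
have {}p'E k : \sum_S outcome_prob J k S * p' S = exp_payment J p k by exact: p'E.
pose V : {set {set 'I_m}} := [set U | p' U != 0].
pose l : seq ({set 'I_m} * R) := [seq (U, p' U) | U <- enum V].
have sumE k : \sum_(e <- l) outcome_prob J k e.1 * e.2 = exp_payment J p k.
  rewrite big_map big_enum /= -p'E [RHS](bigID [in V]) /=.
  rewrite [X in _ = _ + X]big1 ?addr0 // => S.
  by rewrite inE negbK => /eqP ->; rewrite mulr0.
have szl : (size l <= n)%N by rewrite size_map -cardE.
have [e el|c cin [/andP[cl cr] ck]] := cands_cover szl.
  case/mapP: el => S _ -> /=; split=> //.
  apply: le_trans p2; rewrite -p'E (bigD1 S) //= lerDl.
  by apply: sumr_ge0 => S' _; rewrite mulr_ge0 ?outcome_prob_ge0.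
exists c; rewrite sumE in cl cr *; split=> //.
apply/(goodP R cin); split; first exact: le_trans cr p2.
move=> k.
have ek : exp_payment J p k - cost J k <= exp_payment J p i - cost J i.
  by have [->//|ki] := eqVneq k i; have := ic k ki; rewrite /agent_utility subr0.
have := ck k; rewrite sumE.
have hm : 2 * m%:R <= h.
  rewrite /h /grid -(natrM R 2) ler_nat; apply: leq_trans (leq_pmulr _ _); lia.
have thl := growth_le h_gt0 hm; rewrite -/theta in thl.
have pk0 : 0 <= exp_payment J p k.
  by apply: sumr_ge0 => S _; rewrite mulr_ge0 ?outcome_prob_ge0.
have /andP[ck0 ck1] := cost_le1 k; have /andP[ci0 ci1] := cost_le1 i.
(* Incentive compatibility gives [p_k <= p_i + c_k - c_i <= 2 + 1]; this turns the factor [theta]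
   into an additive error. *)
have pk3 : exp_payment J p k <= 3 by lra.
have u0 : 0 <= 2 * m%:R / h by rewrite divr_ge0 ?mulr_ge0 // ltW.
have th_pk : theta * exp_payment J p k <= exp_payment J p k + 3 * (2 * m%:R / h).
  apply: le_trans (ler_wpM2r pk0 thl) _.
  rewrite mulrDl mul1r lerD2l mulrC ler_wpM2r //.
have err := grid_error; rewrite mulrDl in err.
have szn : 3 * (size l)%:R / h <= 3 * n%:R / h.
  by rewrite ler_pM2r ?invr_gt0 // ler_pM2l // ler_nat.
rewrite -/total => tk.
have e6 : 3 * (2 * m%:R / h) = 6 * m%:R / h by rewrite !mulrA -natrM.
move: tk cl; rewrite -/J -/i /total => tk cl; lra.
Qed.

Lemma best_spec :
  match best x with
  | Some c => [/\ c \in cands n n (opts x), good x c &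
      forall p, is_contract p -> implements J p i -> total c i <= exp_payment J p i]
  | None => forall p, is_contract p -> implements J p i -> 2 < exp_payment J p i
  end.
Proof.
case E: (best x) => [c|].
  have [cin cg] := select_mem E; split=> // p p0 [ic _].
  (* Contracts above the cap lose to any acceptable candidate; the others are matched by some
     candidate in the search. *)
  have [p2|/ltW p2] := leP (exp_payment J p i) 2; last first.
    by have [c2 _] := goodP R cin cg; apply: le_trans c2 p2.
  have [c' [c'in c'g c'p]] := exists_good p0 ic p2.
  have [b] := select_min c'in c'g; rewrite -/(best x) E => -[<-] le_cc'.
  apply: le_trans c'p.
  rewrite /total (total_paymentE R _ cin) (total_paymentE R _ c'in).
  rewrite ler_pM2r ?invr_gt0 ?mulr_gt0 ?ltr0z ?denom_gt0 // ler_int.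
  have [_ Ec] := cands_wf cin; have [_ Ec'] := cands_wf c'in.
  by move: le_cc'; rewrite Ec Ec'.
move=> p p0 [ic _]; rewrite ltNge; apply/negP => p2.
have [c' [c'in c'g c'p]] := exists_good p0 ic p2.
by have [b] := select_min c'in c'g; rewrite -/(best x) E.
Qed.

End Optimality.

(** * From the selected candidate to the encoded answer *)

Lemma enc_rat_grid H (z : int * int) : (0 < H)%N ->
  (exists2 b : int, 0 <= b & z = (b * H%:Z + 1, H%:Z * H%:Z)) ->
  enc_rat (z.1%:~R / z.2%:~R) = eQ z.
Proof.
move=> H0 [b b0 ->] /=.
have cop : coprime `|b * H%:Z + 1| `|H%:Z * H%:Z|.
  rewrite abszM coprimeMr andbb absz_nat.
  case: b b0 => // b _; rewrite -PoszM -PoszD absz_nat.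
  by rewrite coprime_sym /coprime gcdnMDl gcdn1.
rewrite /enc_rat /eQ /epair /eZ /= coprimeq_num // coprimeq_den //.
have HH0 : 0 < H%:Z * H%:Z by rewrite mulr_gt0 // ltz_nat.
by rewrite gtr0_sg // mul1r gt_eqF // gtr0_norm.
Qed.

Definition sparse_entry m (e : seq bool * (int * int)) : {set 'I_m} * rat :=
  (set_of_bits m e.1, e.2.1%:~R / e.2.2%:~R).

Lemma enc_answer_best n (x : instances n) :
  (if best x is Some c then Pair (Int 1) (enc_seq eEntry c.1) else Int 0) =
  enc_answer (omap (fun c : cand => [seq sparse_entry (im x) e | e <- c.1]) (best x)).
Proof.
case E: (best x) => [c|] //=; congr (Pair _ _).
have [/cands_wf[wf _] _] := select_mem E.
elim: (c.1) wf => //= e es IH wf.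
have [sz pay] := wf e (mem_head _ _).
rewrite -IH => [|e' e'in]; last by apply: wf; rewrite inE e'in orbT.
congr (Pair (Pair _ _) _); last by rewrite (enc_rat_grid (grid_gt0 x) pay).
by rewrite /enc_set /enc_fun -/(bits_of _) set_of_bitsK.
Qed.

Lemma sparse_entry_payment (R : realType) n (x : instances n) c t k :
  c \in cands n t (opts x) ->
  exp_payment (map_setting ratr (iI x)) (contract_of R [seq sparse_entry (im x) e | e <- c.1]) k
    = total_payment R x c k.
Proof.
move=> /cands_wf[wf _]; rewrite exp_payment_sparse big_map.
apply: eq_big_seq => e /wf[sz _]; rewrite outcome_probE /= set_of_bitsK //.
by rewrite fmorph_div /= !ratr_int.
Qed.

Lemma sparse_entry_contract (R : realType) n (x : instances n) c t :
  c \in cands n t (opts x) ->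
  is_contract (contract_of R [seq sparse_entry (im x) e | e <- c.1]).
Proof.
move=> /cands_wf[wf _] S; rewrite ffunE ler0q big_map.
rewrite big_seq_cond; apply: sumr_ge0 => e /andP[/wf[_ [b b0 Eb]] _] /=.
by rewrite Eb /= divr_ge0 ?ler0z // ?mulr_ge0 // addr_ge0 ?mulr_ge0.
Qed.

Lemma size_parameter_le n (x : instances n) : ok x ->
  (sz x).+1%:R <= 2 * ((im x)%:R + (iB x)%:R + (idelta x)^-1) :> rat.
Proof.
move=> [_ d0 [_ _ _ dB]].
(* The denominator of [delta] takes at least one bit, so [B] absorbs the successor in the size
   parameter; hence the factor 2. *)
have B1 : (1 <= iB x)%N.
  apply: leq_trans dB; rewrite /rat_bits ltn_addl // /bit_length up_log_gt0 /=.
  by rewrite ltnS absz_gt0 denq_neq0.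
have fl : (inv_floor (idelta x))%:R <= (idelta x)^-1 :> rat.
  rewrite pmulrn inv_floorE // -[X in X^-1]divq_num_den invf_div ler_pdivlMr ?ltr0z ?numq_gt0 //.
  by rewrite -intrM ler_int lez_floor // gt_eqF // numq_gt0.
rewrite /= -natr1 !natrD.
have : 1 <= (iB x)%:R :> rat by rewrite ler1n.
have : 0 <= (im x)%:R :> rat by [].
have : 0 <= (idelta x)^-1 by rewrite invr_ge0 ltW.
lra.
Qed.

Theorem mainTheorem1 (R : realType) (n : nat) :
  exists (alg : prog) (K d : nat),
  forall (m B : nat) (I : setting rat n m) (i : 'I_n) (delta : rat),
    valid_setting I -> 0 < delta -> bits_at_most B I delta ->
    let J : setting R n m := map_setting ratr I in
    exists (ans : option (sparse_contract m)) (t : nat),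
      [/\ runs alg (enc_input I i delta) (enc_answer ans) t,
          t%:R <= K%:R * (m%:R + B%:R + delta^-1) ^+ d &
          match ans with
          | Some s =>
              let p := contract_of R s in
              [/\ is_contract p, dIC J (ratr delta) p i &
                  ((exp_payment J p i)%:E <= OPT J i)%E]
          | None => (1%:E < OPT J i)%E
          end].
Proof.
have [alg [T [_ [K [d bT]] runsT]]] := pc_answer n.
(* [2 ^ d] pays for the factor 2 in [size_parameter_le]. *)
exists alg, (K * 2 ^ d)%N, d => m B I i delta vI d0 bI J.
pose x : instances n := Inst B I i delta.
have okx : ok x by split.
have [t r tT] := runsT x okx; rewrite enc_answer_best in r.
exists (omap (fun c : cand => [seq sparse_entry m e | e <- c.1]) (best x)), t.
split=> //.
  apply: (@le_trans _ _ (K * (sz x).+1 ^ d)%N%:R).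
    by rewrite ler_nat; apply: leq_trans tT (bT x okx).
  rewrite !natrM !natrX -mulrA ler_wpM2l // -exprMn.
  rewrite lerXn2r ?nnegrE //; last exact: size_parameter_le okx.
  by rewrite mulr_ge0 // !addr_ge0 // invr_ge0 ltW.
have := best_spec R okx; case: (best x) => [c|] /= spec.
  have [cin cg copt] := spec; split.
  - exact: sparse_entry_contract cin.
  - move=> k _; have [_ ic] := goodP R cin cg.
    by rewrite /agent_utility !(sparse_entry_payment R _ cin); apply: ic.
  - apply/ereal_infP => _ [p [p0 pI] <-].
    by rewrite lee_fin (sparse_entry_payment R _ cin); apply: copt.
(* Every implementing contract pays more than 2, but the infimum only inherits a weak inequality;
   the strict one comes from the gap between 1 and 2. *)
apply: (@lt_le_trans _ _ 2%:E); first by rewrite lte_fin ltr1n.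
apply/ereal_infP => _ [p [p0 pI] <-].
by rewrite lee_fin ltW // spec.
Qed.
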